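(* Let $M$ be a simple matroid on $[n]=\{1,\dots,n\}$ of rank $r\geq 2$. (i) For every $\mathbf a\in\mathbb R_{>0}^n$ the Hessian matrix $H_{f_M}|_{\mathbf x=\mathbf a}$ has signature $(+,-,\dots,-)$; in particular $f_M$ is strictly log-concave on $\mathbb R_{>0}^n$. (ii) If $M$ is not a uniform matroid, then for every $\mathbf a=(a_0,a_1,\dots,a_n)\in\mathbb R^{n+1}$ with $a_0\geq 0$ and $a_1,\dots,a_n>0$, the Hessian matrix $H_{\overline P_M}|_{\mathbf x=\mathbf a}$ has signature $(+,-,\dots,-)$.
   Context: For a matroid $M$ on $[n]$ with set of bases $\mathcal B(M)$ and set of independent sets $\mathcal I(M)$, the basis generating polynomial is $f_M=\sum_{B\in\mathcal B(M)}\prod_{i\in B}x_i\in\mathbb Z[x_1,\dots,x_n]$, the independent set generating polynomial is $P_M=\sum_{I\in\mathcal I(M)}\big(\prod_{i\in I}x_i\big)x_0^{n-|I|}\in\mathbb Z[x_0,\dots,x_n]$, and the reduced independent set generating polynomial is $\overline P_M=(\partial/\partial x_0)^{n-r}P_M$ where $r$ is the rank of $M$. For a polynomial $f$, $H_f=(\partial_i\partial_j f)$ is its Hessian matrix, $\partial_i=\partial/\partial x_i$. ''Signature $(+,-,\dots,-)$'' means the symmetric matrix is nonsingular with exactly one positive eigenvalue. A matroid is simple if it has no loops and no pairs of parallel elements; the uniform matroid $U_{r,n}$ has as bases all $r$-element subsets of $[n]$. $f$ is strictly log-concave on an open convex set if $\log f$ is strictly concave there. *)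

(* Defs.v *)
From HB Require Import structures.
From mathcomp Require Import all_boot all_order all_algebra.
(* The notations of mpoly clash with those of MathComp-Analysis. *)
From mathcomp Require Import -(notations) mpoly.
From mathcomp Require Import classical_sets reals exp.

Set Implicit Arguments.
Unset Strict Implicit.
Unset Printing Implicit Defensive.

Import Order.TTheory GRing.Theory Num.Theory.

Local Open Scope ring_scope.

Record matroid (n : nat) := Matroid {
  bases : {set {set 'I_n}};
  bases_neq0 : exists B, B \in bases;
  bases_exchange : forall B1 B2 x,
    B1 \in bases -> B2 \in bases -> x \in B1 :\: B2 ->
    exists2 y, y \in B2 :\: B1 & y |: (B1 :\ x) \in bases
}.

Definition indep_sets n (M : matroid n) : {set {set 'I_n}} :=
  [set I : {set 'I_n} | [exists B in bases M, I \subset B]].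

(* All bases have the same cardinality, see mrankE below. *)
Definition mrank n (M : matroid n) : nat := (\max_(B in bases M) #|B|)%N.

Definition is_loop n (M : matroid n) (i : 'I_n) : bool :=
  [set i] \notin indep_sets M.

Definition are_parallel n (M : matroid n) (i j : 'I_n) : bool :=
  [&& i != j, ~~ is_loop M i, ~~ is_loop M j &
      [set i; j] \notin indep_sets M].

Definition simple_matroid n (M : matroid n) : Prop :=
  (forall i, ~~ is_loop M i) /\ (forall i j, ~~ are_parallel M i j).

Definition uniform_matroid n (M : matroid n) : Prop :=
  exists r : nat, (r <= n)%N /\ bases M = [set B : {set 'I_n} | #|B| == r].

Definition mvar n (i : 'I_n) : mpoly n int := mpolyX int (mnm1 i).

Definition basis_poly n (M : matroid n) : mpoly n int :=
  \sum_(B in bases M) \prod_(i in B) mvar i.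

(* The extra variable x_0 has index ord0 and x_i has index lift ord0 i. *)
Definition indep_poly n (M : matroid n) : mpoly n.+1 int :=
  \sum_(I in indep_sets M)
    (\prod_(i in I) mvar (lift ord0 i)) * mvar ord0 ^+ (n - #|I|).

Definition reduced_indep_poly n (M : matroid n) : mpoly n.+1 int :=
  iter (n - mrank M) (mderiv ord0) (indep_poly M).

Definition poly_at (R : realType) n (f : mpoly n int) (a : 'rV[R]_n) : R :=
  meval (fun i => a ord0 i) (map_mpoly (fun z : int => z%:~R) f).

Definition hessian n (f : mpoly n int) : 'M[mpoly n int]_n :=
  \matrix_(i, j) mderiv i (mderiv j f).

Definition hessian_at (R : realType) n (f : mpoly n int) (a : 'rV[R]_n) :
    'M[R]_n :=
  map_mx (fun g => poly_at g a) (hessian f).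

(* The sequence s lists the eigenvalues of A with multiplicity. *)
Definition lorentzian_signature (R : realType) n (A : 'M[R]_n) : Prop :=
  [/\ A^T = A, A \in unitmx &
      exists2 s : seq R, char_poly A = \prod_(x <- s) ('X - x%:P) &
        count (fun x => 0 < x) s = 1%N].

Definition positive_orthant (R : realType) n : set 'rV[R]_n :=
  [set a | forall i, 0 < a ord0 i]%classic.

Definition strictly_concave_on (R : realType) n (D : set 'rV[R]_n)
    (g : 'rV[R]_n -> R) : Prop :=
  forall x y t, D x -> D y -> x <> y -> 0 < t < 1 ->
    t * g x + (1 - t) * g y < g (t *: x + (1 - t) *: y).

(* Since ln is 0 at nonpositive arguments, positivity is required explicitly. *)
Definition strictly_log_concave_on (R : realType) n (D : set 'rV[R]_n)
    (f : 'rV[R]_n -> R) : Prop :=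
  (forall x, D x -> 0 < f x) /\ strictly_concave_on D (fun x => ln (f x)).

Lemma bases_card_le n (M : matroid n) B1 B2 :
  B1 \in bases M -> B2 \in bases M -> (#|B1| <= #|B2|)%N.
Proof.
move=> b1 b2; have [k] := ubnP #|B1 :\: B2|.
elim: k => // k IHk in B1 b1 * => ltk.
have [/eqP|[x xD]] := set_0Vmem (B1 :\: B2).
  by rewrite finset.setD_eq0; apply: subset_leq_card.
have [y yD b3] := bases_exchange b1 b2 xD.
have [xB1 xB2] : x \in B1 /\ x \notin B2 by move: xD; rewrite inE => /andP[].
have [yB2 yB1] : y \in B2 /\ y \notin B1 by move: yD; rewrite inE => /andP[].
have -> : #|B1| = #|y |: B1 :\ x|.
  by rewrite cardsU1 !inE (negPf yB1) andbF (cardsD1 x B1) xB1.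
apply: IHk => //; rewrite -ltnS; apply: leq_trans ltk; rewrite ltnS.
apply/proper_card/properP; split.
  apply/fintype.subsetP=> z; rewrite !inE => /andP[zB2 /orP[/eqP zy|/andP[_ ->]]].
    by rewrite zy yB2 in zB2.
  by rewrite zB2.
exists x => //; rewrite !inE eqxx orbF xB2 /=.
by apply: contraNneq xB2 => ->.
Qed.

Lemma mrankE n (M : matroid n) B : B \in bases M -> mrank M = #|B|.
Proof.
move=> bB; apply/eqP; rewrite eqn_leq (leq_bigmax_cond _ bB) andbT.
by apply/bigop.bigmax_leqP=> B' bB'; exact: bases_card_le bB' bB.
Qed.

(* Main.v *)
(** For a set [K] and [N, d : nat] consider the homogeneous polynomials
      g(K, N, d) = sum_J (N + d - #|J|)! / (d - #|J|)! x_0^(d - #|J|) x^J,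
    where [J] ranges over the sets of size at most [d] disjoint from [K] with
    [J :|: K] independent.  The family is closed under partial derivatives,
    contains the reduced independent set polynomial, and at x_0 = 0 its Hessian
    contains a multiple of the Hessian of the basis polynomial as a principal
    submatrix.

    If the contraction of [K] has at most N + d nonloops, the Hessian of
    g(K, N, d) satisfies the reverse Cauchy-Schwarz inequality at points with
    x_0 >= 0 and x_i > 0.  For d = 2 this is Cauchy-Schwarz for the sums over
    the parallel classes; the induction on d is the local-to-global principle
    for the Hessians of the partial derivatives, and x_0 = 0 is a limit case.

    A vector in the kernel of the Hessian is in the kernel of the Hessians of
    the derivatives, hence of all the quadratic ones.  There it forces the
    coordinate of index 0 to vanish as soon as some rank 2 contraction has
    fewer than N + 2 parallel classes, and then, descending through the
    contractions of a simple matroid, all other coordinates too.  Nonuniformity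
    provides such a contraction for N = n - r; for the basis polynomial one is
    free to choose N = n. *)
Require Import Defs.
From HB Require Import structures.
From mathcomp Require Import classical_sets reals normedtype.
From mathcomp Require Import derive realfun exp.
From mathcomp Require Import all_boot all_order all_algebra.
From mathcomp Require Import spectral complex polyrcf.
From mathcomp Require Import ring lra.
From mathcomp Require Import -(notations) mpoly.

Set Implicit Arguments.
Unset Strict Implicit.
Unset Printing Implicit Defensive.

Import Order.TTheory GRing.Theory Num.Theory.
Import numFieldNormedType.Exports.
Local Open Scope ring_scope.

(** * Bilinear forms and the reverse Cauchy-Schwarz inequality *)

Section BilinearForm.
Variables (R : rcfType) (n : nat).
Implicit Types (H : 'M[R]_n) (u v w : 'rV[R]_n).

Definition bform H u v : R := (u *m H *m v^T) 0 0.

Lemma bformE H u v : bform H u v = \sum_i \sum_j u 0 i * H i j * v 0 j.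
Proof.
rewrite /bform mxE exchange_big; apply: eq_bigr => j _.
by rewrite !mxE mulr_suml.
Qed.

Lemma bformDl H u v w : bform H (u + v) w = bform H u w + bform H v w.
Proof. by rewrite /bform !mulmxDl mxE. Qed.

Lemma bformDr H u v w : bform H w (u + v) = bform H w u + bform H w v.
Proof. by rewrite /bform linearD mulmxDr mxE. Qed.

Lemma bformZl H c u v : bform H (c *: u) v = c * bform H u v.
Proof. by rewrite /bform -!scalemxAl mxE. Qed.

Lemma bformZr H c u v : bform H u (c *: v) = c * bform H u v.
Proof. by rewrite /bform linearZ -scalemxAr mxE. Qed.

Lemma bform_sym H u v : H^T = H -> bform H u v = bform H v u.
Proof.
move=> Hs; rewrite /bform; have {1}-> : u *m H *m v^T = (v *m H *m u^T)^T.
  by rewrite !trmx_mul trmxK Hs mulmxA.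
by rewrite mxE.
Qed.

Lemma bform1_dot u v : bform 1%:M u v = \sum_i u 0 i * v 0 i.
Proof. by rewrite /bform mulmx1 mxE; apply: eq_bigr => i _; rewrite mxE. Qed.

Lemma bform1E u : bform 1%:M u u = \sum_i u 0 i ^+ 2.
Proof. by rewrite bform1_dot; apply: eq_bigr => i _; rewrite expr2. Qed.

Lemma mulmx_tr_row v (P : 'M[R]_n) i : (v *m P^T) 0 i = bform 1%:M v (row i P).
Proof. by rewrite bform1_dot mxE; apply: eq_bigr => j _; rewrite !mxE. Qed.

Lemma bform1_ge0 u : 0 <= bform 1%:M u u.
Proof. by rewrite bform1E sumr_ge0 // => i _; exact: sqr_ge0. Qed.

Lemma bform1_eq0 u : (bform 1%:M u u == 0) = (u == 0).
Proof.
apply/eqP/eqP => [|->]; last by rewrite /bform !mul0mx mxE.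
rewrite bform1E => /eqP; rewrite psumr_eq0 => [/allP h|i _]; last exact: sqr_ge0.
apply/rowP => i; rewrite mxE; apply/eqP; rewrite -sqrf_eq0.
by have := h i (mem_index_enum _).
Qed.

(** For symmetric [H] with [bform H a a > 0] this means that [H] is negative semidefinite on the
    [H]-orthogonal of [a], that is, has exactly one positive eigenvalue. *)
Definition reverse_cauchy_schwarz H a :=
  forall v, bform H a a * bform H v v <= bform H a v ^+ 2.

(** The inequality at one positive vector [e] already limits [H] to a single positive eigenvalue, a
    property that does not refer to [e]. *)
Lemma rcs_transfer H e a : H^T = H -> 0 < bform H e e ->
  reverse_cauchy_schwarz H e -> 0 <= bform H a a -> reverse_cauchy_schwarz H a.
Proof.
move=> Hs e0 he; rewrite le_eqVlt => /predU1P[a0|a0] v.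
  by rewrite -a0 mul0r sqr_ge0.
have eq_a : bform H e a != 0.
  apply/eqP => h; have := he a; rewrite h expr0n /= leNgt.
  by rewrite mulr_gt0.
(* [v - s *: a] is [H]-orthogonal to [e], so the form is nonpositive there. A quadratic in [s] with
   positive leading coefficient [bform H a a] thus takes a nonpositive value, and its discriminant
   is nonnegative. *)
pose s := bform H e v / bform H e a.
have hs : s * bform H e a = bform H e v by rewrite divfK.
have := he (v - s *: a).
rewrite -scaleNr !bformDr !bformDl !bformZr !bformZl !mulNr hs subrr.
rewrite expr0n /= pmulr_rle0 // (bform_sym v a Hs).
set q := bform H a a; set b := bform H a v; set p := bform H v v => h.
have : q * (p - s * b - s * (b - s * q)) <= 0 .
  by rewrite pmulr_rle0 //; move: h; lra.
have := sqr_ge0 (s * q - b); nra.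
Qed.

Lemma rcs_orth_le0 H a v : 0 < bform H a a -> reverse_cauchy_schwarz H a ->
  bform H a v = 0 -> bform H v v <= 0.
Proof. by move=> a0 ha hv; have := ha v; rewrite hv expr0n /= pmulr_rle0. Qed.

(** On the [H]-orthogonal of [a] the form is negative semidefinite, so an isotropic vector there
    lies in its radical; being orthogonal to [a] too, it is in the kernel of [H]. *)
Lemma rcs_isotropic H a v : H^T = H -> 0 < bform H a a ->
  reverse_cauchy_schwarz H a -> bform H a v = 0 -> bform H v v = 0 ->
  v *m H = 0.
Proof.
move=> Hs a0 ha hav hvv.
have main w : bform H a w = 0 -> bform H v w = 0.
  move=> haw; apply/eqP/negP => /negP hvw.
  (* This [s] makes the form equal to 1 at [s *: v + w], a vector orthogonal to [a]. *)
  pose s := (1 - bform H w w) / (2 * bform H v w).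
  have := rcs_orth_le0 a0 ha (v := s *: v + w).
  rewrite !bformDr !bformDl !bformZr !bformZl hav haw hvv (bform_sym w v Hs).
  rewrite !mulr0 !add0r => /(_ erefl).
  have -> : s * bform H v w + (s * bform H v w + bform H w w) = 1.
    by rewrite /s; field.
  by rewrite ler10.
have {}main w : bform H v w = 0.
  have := main (w - (bform H a w / bform H a a) *: a).
  rewrite -scaleNr !bformDr !bformZr (bform_sym v a Hs) hav mulr0 addr0; apply.
  by rewrite mulNr divfK ?lt0r_neq0 ?subrr.
apply/rowP => j; rewrite [RHS]mxE.
by have := main (delta_mx 0 j); rewrite /bform trmx_delta -colE [LHS]mxE.
Qed.

End BilinearForm.

(** * Diagonalization of real symmetric matrices *)

Section Spectral.
Variable R : rcfType.

(* A complex eigenvector u + iw with eigenvalue b + ic gives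
   uA = bu - cw and wA = bw + cu, and the symmetry of A forces c = 0. *)
Lemma symmetric_eigenvector n (A : 'M[R]_n.+1) : A^T = A ->
  exists c, exists2 v : 'rV[R]_n.+1, v != 0 & v *m A = c *: v.
Proof.
move=> As; pose toC := real_complex R.
have [//|[b c] /eigenvalueP[p pA p0]] := @eigenvalue_closed _ _ (map_mx toC A).
pose u : 'rV[R]_n.+1 := \row_j complex.Re (p 0 j).
pose w : 'rV[R]_n.+1 := \row_j complex.Im (p 0 j).
have ReS (F : 'I_n.+1 -> R[i]) :
    complex.Re (\sum_i F i) = \sum_i complex.Re (F i).
  by apply: (big_morph _ _ erefl) => -[x y] [z t].
have ImS (F : 'I_n.+1 -> R[i]) :
    complex.Im (\sum_i F i) = \sum_i complex.Im (F i).
  by apply: (big_morph _ _ erefl) => -[x y] [z t].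
have uA : u *m A = b *: u - c *: w.
  apply/rowP => j; move/matrixP/(_ 0 j)/(congr1 (@complex.Re R)): pA.
  rewrite /= [in LHS]mxE ReS !mxE => h.
  transitivity (complex.Re (((b +i* c)%C : R[i]) * p 0 j)); last first.
    by case: (p 0 j).
  rewrite -h; apply: eq_bigr => k _; rewrite !mxE; case: (p 0 k) => x y /=.
  by rewrite mulr0 subr0.
have wA : w *m A = b *: w + c *: u.
  apply/rowP => j; move/matrixP/(_ 0 j)/(congr1 (@complex.Im R)): pA.
  rewrite /= [in LHS]mxE ImS !mxE => h.
  transitivity (complex.Im (((b +i* c)%C : R[i]) * p 0 j)); last first.
    by case: (p 0 j) => x y /=; ring.
  rewrite -h; apply: eq_bigr => k _; rewrite !mxE; case: (p 0 k) => x y /=.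
  by rewrite mulr0 add0r.
have uw0 : (u != 0) || (w != 0).
  rewrite -negb_and; apply: contra p0 => /andP[/eqP u0 /eqP w0].
  apply/eqP/rowP => j; move/rowP/(_ j): u0.
  move/rowP/(_ j): w0; rewrite !mxE.
  by case: (p 0 j) => x y /= -> ->.
have c0 : c = 0.
  have : bform A u w = bform A w u by rewrite bform_sym.
  rewrite /bform uA wA -[_ *m w^T]/(_ *m _) => /eqP.
  have E x y : (x *m y^T) 0 0 = bform 1%:M x y :> R by rewrite /bform mulmx1.
  rewrite !E -scaleNr !bformDl !bformZl (bform_sym w u (trmx1 _ _)).
  rewrite mulNr -subr_eq0 => /eqP h.
  have : c * (bform 1%:M u u + bform 1%:M w w) == 0 by apply/eqP; lra.
  rewrite mulf_eq0 paddr_eq0 ?bform1_ge0 // !bform1_eq0 => /orP[/eqP //|].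
  by move/andP=> [/eqP u0 /eqP w0]; rewrite u0 w0 eqxx in uw0.
rewrite c0 in uA wA; exists b.
case/orP: uw0 => h0; [exists u | exists w] => //.
  by rewrite uA scale0r subr0.
by rewrite wA scale0r addr0.
Qed.

Lemma symmetric_unit_eigenvector n (A : 'M[R]_n.+1) : A^T = A ->
  exists c, exists2 v : 'rV[R]_n.+1, bform 1%:M v v = 1 & v *m A = c *: v.
Proof.
move=> /symmetric_eigenvector[c [v v0 vA]]; exists c.
have q0 : 0 < bform 1%:M v v by rewrite lt_def bform1_eq0 v0 bform1_ge0.
exists ((Num.sqrt (bform 1%:M v v))^-1 *: v).
  rewrite bformZl bformZr mulrA -expr2 exprVn sqr_sqrtr ?bform1_ge0 //.
  by rewrite mulVf ?lt0r_neq0.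
by rewrite -scalemxAl vA !scalerA mulrC.
Qed.

(* Householder reflection *)
Lemma exists_reflection n (v : 'rV[R]_n.+1) : bform 1%:M v v = 1 ->
  exists Q : 'M[R]_n.+1, [/\ Q^T = Q, Q *m Q = 1%:M & delta_mx 0 0 *m Q = v].
Proof.
move=> v1; pose e : 'rV[R]_n.+1 := delta_mx 0 0.
have [->|ve] := eqVneq v e.
  by exists 1%:M; split; rewrite ?trmx1 ?mulmx1.
have [w wE] : exists w, w = v - e by exists (v - e).
pose q := bform 1%:M w w.
have q0 : q != 0 by rewrite bform1_eq0 wE subr_eq0.
have E (x y : 'rV[R]_n.+1) : x *m y^T = (bform 1%:M x y)%:M :> 'M[R]_1.
  by rewrite /bform mulmx1 -mx11_scalar.
have e1 : bform 1%:M e e = 1.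
  by rewrite /bform mulmx1 trmx_delta mul_delta_mx mxE.
have sq : 2 / q * q = 2 by rewrite divfK.
(* As [v] and [e] are unit vectors, [q] is [-2] times the dot product of [e] and [w]. *)
have ew : 2 / q * bform 1%:M e w = -1.
  apply: (mulIf q0); rewrite mulrAC sq mulN1r /q wE -scaleN1r.
  rewrite !bformDr !bformDl !bformZr !bformZl v1 e1.
  by rewrite (bform_sym v e (trmx1 _ _)); ring.
exists (1%:M - (2 / q) *: (w^T *m w)).
move: (2 / q) sq ew (E w w) (E e w); rewrite -/q.
clearbody q => s sq ew ww eww; split.
- by rewrite linearB linearZ /= trmx1 trmx_mul trmxK.
- rewrite mulmxBl mul1mx mulmxBr mulmx1 -scalemxAl -scalemxAr scalerA.
  rewrite -mulmxA (mulmxA w) ww mul_scalar_mx -scalemxAr scalerA -mulrA sq.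
  by rewrite mulrC mulr_natl mulr2n scalerDl opprB addrK subrK.
- rewrite mulmxBr mulmx1 -scalemxAr mulmxA eww mul_scalar_mx scalerA ew.
  by rewrite scaleN1r opprK wE addrC subrK.
Qed.

(** Conjugating by a reflection that carries the first basis vector to a unit eigenvector splits off
    a 1 by 1 block; the induction handles the other block. *)
Theorem symmetric_diagonalization n (A : 'M[R]_n) : A^T = A ->
  exists (P : 'M[R]_n) (d : 'rV[R]_n),
    P *m P^T = 1%:M /\ A = P^T *m diag_mx d *m P.
Proof.
elim: n A => [|n IH] A As.
  by exists 1%:M, 0; split; apply/matrixP => -[].
have [c [v v1 vA]] := symmetric_unit_eigenvector As.
have [Q [Qs QQ eQ]] := exists_reflection v1.
pose e : 'rV[R]_n.+1 := delta_mx 0 0.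
have [B BE] : exists B : 'M[R]_(1 + n), B = Q *m A *m Q by exists (Q *m A *m Q).
have Bs : B^T = B by rewrite BE !trmx_mul Qs As mulmxA.
have eB : e *m B = c *: e.
  by rewrite BE !mulmxA eQ vA -scalemxAl -eQ -mulmxA QQ mulmx1.
have B0 j : B 0 j = c * (j == 0)%:R.
  have /matrixP/(_ 0 j) := eB; rewrite -rowE !mxE eqxx /= => ->.
  by rewrite eq_sym.
have l0 : lshift n (0 : 'I_1) = 0 :> 'I_(1 + n) by apply/val_inj.
have Bl : B (lshift n 0) (lshift n 0) = c by rewrite l0 B0 mulr1.
have Br j : B (lshift n 0) (rshift 1 j) = 0 by rewrite l0 B0 mulr0.
have [|P [d [PP Bd]]] := IH (drsubmx B).
  by rewrite trmx_drsub Bs.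
have Bblock : B = block_mx c%:M 0 0 (drsubmx B).
  rewrite -[LHS]submxK; congr block_mx.
  - by apply/matrixP => i j; rewrite !ord1 !mxE Bl eqxx.
  - by apply/matrixP => i j; rewrite !ord1 !mxE Br.
  - by rewrite -[dlsubmx B]trmxK trmx_dlsub Bs; apply/matrixP => i j;
       rewrite !ord1 !mxE Br.
have [K KE] : exists K : 'M[R]_(1 + n), K = block_mx 1%:M 0 0 P.
  by exists (block_mx 1%:M 0 0 P).
have KK : K *m K^T = 1%:M.
  rewrite KE tr_block_mx !trmx0 trmx1 mulmx_block !mulmx0 !mul0mx mulmx1 PP.
  by rewrite !addr0 add0r -scalar_mx_block.
have BK : B = K^T *m diag_mx (row_mx c%:M d) *m K.
  rewrite {1}Bblock Bd diag_mx_row KE tr_block_mx !trmx0 trmx1 !mulmx_block.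
  rewrite !mulmx0 !mul0mx !mulmx1 !mul1mx !addr0 !add0r.
  congr block_mx; rewrite ?mul0mx //.
  by apply/matrixP => i j; rewrite !ord1 !mxE ?mulr1n.
exists (K *m Q), (row_mx c%:M d : 'rV_(1 + n)); split.
  rewrite trmx_mul Qs mulmxA -(mulmxA K Q Q) QQ mulmx1 KK.
  by [].
have {1}-> : A = Q *m B *m Q.
  by rewrite BE !mulmxA QQ mul1mx -mulmxA QQ mulmx1.
rewrite trmx_mul Qs {1}BK !mulmxA.
by [].
Qed.

End Spectral.

Section Diagonalized.
Variables (R : rcfType) (n : nat) (A P : 'M[R]_n) (d : 'rV[R]_n).
Hypotheses (PP : P *m P^T = 1%:M) (Ad : A = P^T *m diag_mx d *m P).

Lemma row_diagonalization i : row i P *m A = d 0 i *: row i P.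
Proof.
rewrite Ad !mulmxA -row_mul PP row1 -rowE row_diag_mx -scalemxAl.
by rewrite -rowE.
Qed.

Lemma bform_diagonalization v :
  bform A v v = \sum_i d 0 i * bform 1%:M v (row i P) ^+ 2.
Proof.
rewrite /bform Ad !mulmxA -[_ *m P *m _]mulmxA.
have -> : P *m v^T = (v *m P^T)^T by rewrite trmx_mul trmxK.
rewrite mxE; apply: eq_bigr => i _.
rewrite mul_mx_diag mxE [in X in _ * X]mxE !mulmx_tr_row.
by rewrite expr2 mulrAC mulrC.
Qed.

Lemma bform1_row_diagonalization i j :
  bform 1%:M (row i P) (row j P) = (i == j)%:R.
Proof. by rewrite -mulmx_tr_row -row_mul PP !mxE. Qed.

Lemma bform_row_diagonalization i j :
  bform A (row i P) (row j P) = d 0 i * (i == j)%:R.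
Proof.
rewrite -bform1_row_diagonalization -bformZl -row_diagonalization.
by rewrite /bform mulmx1.
Qed.

Lemma char_poly_diagonalization : char_poly A = \prod_i ('X - (d 0 i)%:P).
Proof.
have PtP : P^T *m P = 1%:M by exact: mulmx1C.
rewrite /char_poly /char_poly_mx.
pose Q := map_mx (@polyC R) P.
have QtQ : Q^T *m Q = 1%:M by rewrite /Q map_trmx -map_mxM PtP map_mx1.
have -> : 'X%:M - map_mx (@polyC R) A
  = Q^T *m ('X%:M - diag_mx (map_mx (@polyC R) d)) *m Q.
  rewrite mulmxBr mulmxBl scalar_mxC -(mulmxA _ Q^T Q) QtQ mulmx1.
  by rewrite Ad !map_mxM map_diag_mx map_trmx.
rewrite !det_mulmx mulrAC -det_mulmx QtQ det1 mul1r.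
rewrite det_trig; first by apply: eq_bigr => i _; rewrite !mxE eqxx.
by apply/is_trig_mxP => i j; rewrite ltn_neqAle => /andP[ij _];
   rewrite !mxE (negbTE (_ : i != j)) // subr0.
Qed.
End Diagonalized.

(** In an orthonormal eigenbasis, a null eigenvector would lie in the hyperplane, the absence of
    positive eigenvalues would contradict the value at [a], and two of them would span a positive
    definite plane, which meets the hyperplane. *)
Lemma lorentzian_signature_of_hyperplane (R : realType) n (A : 'M[R]_n) a :
  A^T = A -> 0 < bform A a a ->
  (forall v, v != 0 -> bform A a v = 0 -> bform A v v < 0) ->
  lorentzian_signature A.
Proof.
move=> As a0 neg; have [P [d [PP Ad]]] := symmetric_diagonalization As.
have p0 i : row i P != 0.
  rewrite -bform1_eq0 (bform1_row_diagonalization PP) eqxx; exact: oner_neq0.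
have d0 i : d 0 i != 0.
  apply/eqP => di; have pA := row_diagonalization PP Ad i.
  rewrite di scale0r in pA; have := neg _ (p0 i).
  rewrite bform_sym // /bform pA !mul0mx mxE ltxx => /(_ erefl).
  by [].
have [i0 di0] : exists i, 0 < d 0 i.
  apply/existsP; rewrite -[X in is_true X]negbK negb_exists; apply/negP.
  move/forallP => h; move: a0; rewrite (bform_diagonalization Ad) ltNge.
  rewrite sumr_le0 // => i _; rewrite mulr_le0_ge0 ?sqr_ge0 // leNgt.
  exact: h.
have uniq_pos i : (0 < d 0 i) = (i == i0).
  apply/idP/eqP => [di|->//]; apply/eqP/negP => /negP ii0.
  pose x := bform A a (row i0 P); pose y := bform A a (row i P).
  pose v := x *: row i P - y *: row i0 P.
  have av : bform A a v = 0.
    by rewrite /v -scaleNr bformDr !bformZr -/x -/y mulNr mulrC subrr.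
  have qv : bform A v v = x ^+ 2 * d 0 i + y ^+ 2 * d 0 i0.
    rewrite /v -scaleNr !bformDr !bformDl !bformZr !bformZl.
    rewrite !(bform_row_diagonalization PP Ad) !eqxx [i0 == i]eq_sym (negbTE ii0).
    by rewrite !mulr1n !mulr0n; ring.
  have x0 : x != 0.
    apply/eqP => x0; have := neg _ (p0 i0) x0.
    by rewrite (bform_row_diagonalization PP Ad) eqxx mulr1 ltNge ltW.
  have v0 : v != 0.
    apply/eqP => v0; have := bform1_row_diagonalization PP i i.
    have : bform 1%:M v (row i P) = x.
      rewrite /v -scaleNr bformDl !bformZl !(bform1_row_diagonalization PP).
      by rewrite eqxx [i0 == i]eq_sym (negbTE ii0) mulr1 mulr0 addr0.
    by rewrite v0 /bform !mul0mx mxE => xe; rewrite -xe eqxx in x0.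
  have := neg _ v0 av; rewrite qv ltNge addr_ge0 //;
    by rewrite mulr_ge0 ?sqr_ge0 // ltW.
split=> //.
  rewrite unitmxE Ad !det_mulmx det_diag mulrAC -det_mulmx (mulmx1C PP) det1.
  by rewrite mul1r; apply: unitr_prod => i _; rewrite unitfE.
exists [seq d 0 i | i : 'I_n].
  by rewrite (char_poly_diagonalization PP Ad) big_map enumT.
rewrite count_map -size_filter -(eq_filter (a1 := pred1 i0)).
  by rewrite size_filter count_uniq_mem ?enum_uniq // mem_enum.
by move=> i; rewrite /= uniq_pos.
Qed.

(** * The local-to-global principle *)

Section LocalToGlobal.
Variables (R : rcfType) (m : nat).
Implicit Types (H : 'M[R]_m) (a v : 'rV[R]_m).

Lemma rcs_of_orth_le0 H a : H^T = H -> 0 < bform H a a ->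
  (forall v, bform H a v = 0 -> bform H v v <= 0) -> reverse_cauchy_schwarz H a.
Proof.
move=> Hs a0 h v; pose s := bform H a v / bform H a a.
have sa : s * bform H a a = bform H a v by rewrite divfK ?lt0r_neq0.
have := h (v - s *: a); rewrite -scaleNr !bformDr !bformDl !bformZr !bformZl.
rewrite (bform_sym v a Hs) !mulNr sa subrr => /(_ erefl).
set q := bform H a a in sa a0 *; set b := bform H a v in sa *.
set p := bform H v v => h0.
have {h0} : p - s * b <= 0 by move: h0; rewrite ?mulr0 ?subr0 ?oppr0; lra.
rewrite -(pmulr_rle0 _ a0).
have -> : q * (p - s * b) = q * p - (s * q) * b by ring.
by rewrite sa -expr2 subr_le0.
Qed.

(** [T k] stands for the Hessian of the k-th partial derivative and [cHE] for Euler's identity. The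
    index [o] is adjacent to every index with a nonzero row in [H]; this connectedness makes the
    Perron eigenvalue simple. *)
Variables (H : 'M[R]_m) (T : 'I_m -> 'M[R]_m) (a : 'rV[R]_m) (o : 'I_m) (c : R).
Hypotheses (c0 : 0 < c) (a0 : forall i, 0 < a 0 i).
Hypotheses (T_tr : forall k, (T k)^T = T k).
Hypotheses (T_sym : forall i j k, T i j k = T j i k).
Hypotheses (T_ge0 : forall i j k, 0 <= T i j k).
Hypotheses (cHE : forall i j, c * H i j = \sum_k a 0 k * T k i j).
Hypotheses (T_rcs : forall k, reverse_cauchy_schwarz (T k) a).
Hypotheses (o_adj : forall i, (a *m H) 0 i != 0 -> 0 < H o i).

Let Tt i j k : T i j k = T i k j.
Proof. by rewrite -[in LHS]T_tr mxE. Qed.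

Let Hs : H^T = H.
Proof.
apply/matrixP => i j; apply: (mulfI (lt0r_neq0 c0)); rewrite mxE !cHE.
by apply: eq_bigr => k _; rewrite -[in RHS]T_tr mxE.
Qed.

Let H_ge0 i j : 0 <= H i j.
Proof.
rewrite -(pmulr_rge0 _ c0) cHE sumr_ge0 // => k _.
by rewrite mulr_ge0 // ltW.
Qed.

Let h i := (a *m H) 0 i.

Let hE i : h i = \sum_j H i j * a 0 j.
Proof.
by rewrite /h mxE; apply: eq_bigr => j _; rewrite mulrC -[in LHS]Hs mxE.
Qed.

Let h_ge0 i : 0 <= h i.
Proof. by rewrite hE sumr_ge0 // => j _; rewrite mulr_ge0 // ltW. Qed.

Let H_eq0 i j : h i = 0 -> H i j = 0.
Proof.
move=> /eqP; rewrite hE psumr_eq0 => [/allP/(_ j (mem_index_enum _))|k _].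
  by rewrite mulf_eq0 (gt_eqF (a0 j)) orbF => /eqP.
by rewrite mulr_ge0 // ltW.
Qed.

(** [T] is symmetric in its three indices, so contracting any one of them with [a] gives [c] times
    [H]. *)
Lemma tensor_mulmx v i : c * (v *m H) 0 i = bform (T i) a v.
Proof.
rewrite bformE mxE mulr_sumr exchange_big; apply: eq_bigr => j _ /=.
rewrite mulrCA cHE mulr_sumr; apply: eq_bigr => k _.
by rewrite Tt T_sym; ring.
Qed.

Lemma tensor_bform v : c * bform H v v = \sum_i a 0 i * bform (T i) v v.
Proof.
rewrite bformE mulr_sumr; under [RHS]eq_bigr do rewrite bformE mulr_sumr.
rewrite [RHS]exchange_big; apply: eq_bigr => i _ /=.
rewrite mulr_sumr; under [RHS]eq_bigr do rewrite mulr_sumr.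
rewrite [RHS]exchange_big; apply: eq_bigr => j _ /=.
have -> : c * (v 0 i * H i j * v 0 j) = v 0 i * v 0 j * (c * H i j) by ring.
rewrite cHE mulr_sumr.
by apply: eq_bigr => k _; ring.
Qed.

(** By [tensor_mulmx], [T_rcs] reads [c * h i * bform (T i) v v <= (c * (v *m H) 0 i) ^+ 2]; divide
    by [c * h i] and sum with weights [a 0 i]. *)
Let bform_le_sq v : bform H v v <= \sum_i a 0 i / h i * (v *m H) 0 i ^+ 2.
Proof.
rewrite -(ler_pM2l c0) tensor_bform mulr_sumr; apply: ler_sum => i _.
have := T_rcs i v; rewrite -!tensor_mulmx -/(h i).
have [hi|hi] := eqVneq (h i) 0.
  (* If [h i = 0], the nonnegative matrix [T i] vanishes, and the term on the right is 0 because the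
     inverse of 0 is 0. *)
  have T0 j k : T i j k = 0.
    have := tensor_mulmx a i; rewrite -/(h i) hi mulr0 bformE => /esym/eqP.
    rewrite psumr_eq0 => [/allP/(_ j (mem_index_enum _))|? _]; last first.
      by rewrite sumr_ge0 // => ? _; rewrite !mulr_ge0 // ltW.
    rewrite psumr_eq0 => [/allP/(_ k (mem_index_enum _))|? _]; last first.
      by rewrite !mulr_ge0 // ltW.
    by rewrite !mulf_eq0 !(gt_eqF (a0 _)) orbF /= => /eqP.
  move=> _; rewrite hi invr0 mulr0 mul0r mulr0 bformE big1 ?mulr0 // => j _.
  by rewrite big1 // => k _; rewrite T0 mulr0 mul0r.
have h0 : 0 < h i by rewrite lt_def hi h_ge0.
rewrite exprMn expr2 -!mulrA ler_pM2l // => le.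
rewrite [leRHS]mulrCA ler_pM2l // [leRHS]mulrCA -(ler_pM2l h0).
by rewrite [leRHS]mulrA mulfV // mul1r.
Qed.

(** This is the Laplacian of the graph with edge weights [H i j * a 0 i * a 0 j], evaluated at the
    ratios [v 0 i / a 0 i]. *)
Let amgm v : \sum_i h i / a 0 i * v 0 i ^+ 2 - bform H v v =
  \sum_i \sum_j H i j * a 0 i * a 0 j * (v 0 i / a 0 i - v 0 j / a 0 j) ^+ 2 / 2.
Proof.
have an i : a 0 i != 0 by rewrite lt0r_neq0.
pose E i j := H i j * a 0 i * a 0 j * (v 0 i / a 0 i) ^+ 2.
have EE : \sum_i \sum_j E i j = \sum_i h i / a 0 i * v 0 i ^+ 2.
  apply: eq_bigr => i _; rewrite hE !mulr_suml; apply: eq_bigr => j _.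
  by rewrite /E; field.
have E2 : \sum_i \sum_j E i j = \sum_i \sum_j (E i j + E j i) / 2.
  have -> : \sum_i \sum_j (E i j + E j i) / 2 =
     (\sum_i \sum_j E i j + \sum_i \sum_j E j i) / 2.
    rewrite -big_split mulr_suml; apply: eq_bigr => i _ /=.
    by rewrite -big_split mulr_suml.
  by rewrite [X in _ + X]exchange_big /=; field.
rewrite -EE E2 bformE -sumrB; apply: eq_bigr => i _; rewrite -sumrB.
apply: eq_bigr => j _; rewrite /E.
have -> : H j i = H i j by rewrite -[in LHS]Hs mxE.
by field; rewrite !an.
Qed.

(** The entries of D^1/2. Where [sg i] is 0 its inverse is 0 too, so [S] has a zero row and column
    there. *)
Let sg i := Num.sqrt (h i / a 0 i).
Let S : 'M[R]_m := \matrix_(i, j) ((sg i)^-1 * H i j * (sg j)^-1).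
Let scale (w : 'rV[R]_m) : 'rV[R]_m := \row_i ((sg i)^-1 * w 0 i).

Let sg2 i : sg i ^+ 2 = h i / a 0 i.
Proof. by rewrite sqr_sqrtr // divr_ge0 // ltW. Qed.

Let sg_eq0 i : (sg i == 0) = (h i == 0).
Proof. by rewrite -sqrf_eq0 sg2 mulf_eq0 invr_eq0 (gt_eqF (a0 i)) orbF. Qed.

Let bform_scale w : bform S w w = bform H (scale w) (scale w).
Proof.
rewrite !bformE; apply: eq_bigr => i _; apply: eq_bigr => j _.
by rewrite !mxE; ring.
Qed.

Let mulmx_scale w j : (w *m S) 0 j = (scale w *m H) 0 j * (sg j)^-1.
Proof.
rewrite !mxE mulr_suml; apply: eq_bigr => i _.
by rewrite !mxE; ring.
Qed.

Let S_sym : S^T = S.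
Proof.
apply/matrixP => i j; rewrite !mxE; have -> : H j i = H i j.
  by rewrite -[in LHS]Hs mxE.
by ring.
Qed.

Let S_le_sq w : bform S w w <= bform 1%:M (w *m S) (w *m S).
Proof.
rewrite bform_scale bform1E; apply: le_trans (bform_le_sq _) _.
rewrite le_eqVlt; apply/orP; left; apply/eqP; apply: eq_bigr => i _.
by rewrite mulmx_scale exprMn exprVn sg2 invf_div mulrC.
Qed.

Let scale_sq w : \sum_i h i / a 0 i * scale w 0 i ^+ 2 <= bform 1%:M w w.
Proof.
rewrite bform1E; apply: ler_sum => i _; rewrite mxE -sg2 exprMn mulrA -exprMn.
have [->|si] := eqVneq (sg i) 0; first by rewrite mul0r expr0n mul0r sqr_ge0.
by rewrite mulfV // expr1n mul1r.
Qed.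

Let amgm_ge0 v i j :
  0 <= H i j * a 0 i * a 0 j * (v 0 i / a 0 i - v 0 j / a 0 j) ^+ 2 / 2.
Proof.
rewrite divr_ge0 // mulr_ge0 ?sqr_ge0 // mulr_ge0 ?(ltW (a0 _)) //.
by rewrite mulr_ge0 ?(ltW (a0 _)).
Qed.

Let S_le1 w : bform S w w <= bform 1%:M w w.
Proof.
apply: le_trans (scale_sq w); rewrite bform_scale -subr_ge0 amgm.
by rewrite sumr_ge0 // => i _; rewrite sumr_ge0.
Qed.

(** Equality in [S_le1] kills every square of positive weight in [amgm]. Since [o] is adjacent to
    each [i] with [h i != 0], the ratios [scale w 0 i / a 0 i] at these [i] all equal the one at
    [o]. *)
Let S_fixed w : w *m S = w -> exists x, w = x *: \row_i (sg i * a 0 i).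
Proof.
move=> wS; exists (scale w 0 o / a 0 o); apply/rowP => i; rewrite !mxE.
have [hi|hi] := eqVneq (h i) 0.
  have /eqP s0 : sg i == 0 by rewrite sg_eq0 hi.
  by rewrite -{1}wS mulmx_scale s0 invr0 mulr0 mul0r mulr0.
have si : sg i != 0 by rewrite sg_eq0.
have Ho := o_adj hi.
have : \sum_i h i / a 0 i * scale w 0 i ^+ 2 - bform H (scale w) (scale w) <= 0.
  have wSw : bform S w w = bform 1%:M w w by rewrite /bform wS mulmx1.
  by rewrite -bform_scale subr_le0 wSw scale_sq.
rewrite amgm le_eqVlt ltNge sumr_ge0 ?orbF; last first.
  by move=> k _; rewrite sumr_ge0.
rewrite psumr_eq0 => [/allP/(_ o (mem_index_enum _))|k _]; last first.
  by rewrite sumr_ge0.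
rewrite psumr_eq0 // => /allP/(_ i (mem_index_enum _)).
rewrite !mulf_eq0 !(gt_eqF (a0 _)) (gt_eqF Ho) invr_eq0 pnatr_eq0 !orbF /=.
rewrite orbb subr_eq0 => /eqP E; move: E; rewrite !mxE => ->.
by field; rewrite si lt0r_neq0.
Qed.

(* The symmetric matrix S = D^-1/2 H D^-1/2, with D = diag (h i / a i), satisfies
   S <= S ^ 2 by the inequalities for the T k, and S <= 1 by AM-GM, with equality
   only on the line of the Perron vector.  So its eigenvalues are <= 0 or equal
   to 1, the latter only on that line. *)
Lemma local_to_global : reverse_cauchy_schwarz H a.
Proof.
have [q0|q0] := eqVneq (bform H a a) 0.
  by move=> v; rewrite q0 mul0r sqr_ge0.
have {}q0 : 0 < bform H a a.
  rewrite lt_def q0 bformE sumr_ge0 // => i _; rewrite sumr_ge0 // => j _.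
  by rewrite !mulr_ge0 // ltW.
apply: rcs_of_orth_le0 => // v av.
(* With [w] = D^1/2 [v], being [H]-orthogonal to [a] becomes ordinary orthogonality to the Perron
   vector [u], because [h i = sg i ^+ 2 * a 0 i]. *)
pose w : 'rV[R]_m := \row_i (sg i * v 0 i).
pose u : 'rV[R]_m := \row_i (sg i * a 0 i).
have wu : bform 1%:M w u = 0.
  rewrite -av bform1_dot /bform [RHS]mxE; apply: eq_bigr => i _.
  rewrite -/(h i) !mxE mulrACA -expr2 sg2.
  by field; rewrite lt0r_neq0.
have -> : bform H v v = bform S w w.
  rewrite bform_scale !bformE; apply: eq_bigr => i _; apply: eq_bigr => j _.
  rewrite !mxE.
  have [hi|hi] := eqVneq (h i) 0; first by rewrite H_eq0 // !mulr0 !mul0r.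
  have [hj|hj] := eqVneq (h j) 0.
    by rewrite -Hs mxE H_eq0 // !mulr0 !mul0r.
  by rewrite !mulKf ?sg_eq0.
have [P [d [PP Sd]]] := symmetric_diagonalization S_sym.
rewrite (bform_diagonalization Sd) sumr_le0 // => k _.
have pk : bform 1%:M (row k P) (row k P) = 1.
  by rewrite (bform1_row_diagonalization PP) eqxx.
have pS := row_diagonalization PP Sd k.
have pSp : bform S (row k P) (row k P) = d 0 k.
  by rewrite (bform_row_diagonalization PP Sd) eqxx mulr1.
have := S_le1 (row k P); have := S_le_sq (row k P).
rewrite pSp pS bformZl bformZr pk mulr1 => d2 d1.
have [dle|dgt] := leP (d 0 k) 0; first by rewrite mulr_le0_ge0 ?sqr_ge0.
have dk : d 0 k = 1 by apply/eqP; rewrite eq_le d1 -(ler_pM2l dgt) mulr1.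
have [x xE] : exists x, row k P = x *: u.
  by apply: S_fixed; rewrite pS dk scale1r.
by rewrite xE bformZr wu mulr0 expr0n mulr0.
Qed.

End LocalToGlobal.

(** * The generating polynomials and their derivatives *)

Section Generating.
Variables (n : nat) (F : {set {set 'I_n}}).
Implicit Types (J K : {set 'I_n}) (s : option ({set 'I_n} * nat)).

Definition extends K d : pred {set 'I_n} :=
  fun J => [&& [disjoint J & K], J :|: K \in F & (#|J| <= d)%N].

(* The index Some (K, N) stands for g(K, N, d), with (N + e)! / e! = (N + e) ^_ N,
   and None for the zero polynomial; dstep i is the partial derivative in x_i. *)
Definition gen (A : comNzRingType) (x : 'I_n.+1 -> A) s d : A :=
  if s is Some (K, N) then
    \sum_(J | extends K d J) ((N + (d - #|J|)) ^_ N)%:R *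
      (x ord0 ^+ (d - #|J|) * \prod_(j in J) x (lift ord0 j))
  else 0.

Definition dstep (i : 'I_n.+1) s :=
  if s is Some (K, N) then
    if unlift ord0 i is Some j then
      if j \in K then None else Some (j |: K, N)
    else Some (K, N.+1)
  else None.

Lemma dstep0 K N : dstep ord0 (Some (K, N)) = Some (K, N.+1).
Proof. by rewrite /= unlift_none. Qed.

Lemma dstep_lift j K N :
  dstep (lift ord0 j) (Some (K, N)) = if j \in K then None else Some (j |: K, N).
Proof. by rewrite /= liftK. Qed.

Lemma dstepC i j s : dstep i (dstep j s) = dstep j (dstep i s).
Proof.
case: s => [[K N]|//].
case: (unliftP ord0 i) => [i' ->|->]; case: (unliftP ord0 j) => [j' ->|->];
  rewrite ?dstep0 ?dstep_lift ?dstep0 //.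
- have [jK|jK] := boolP (j' \in K); have [iK|iK] := boolP (i' \in K);
    rewrite ?dstep_lift ?in_setU1 ?jK ?iK ?orbT //= ?orbF.
  by rewrite (negbTE iK) (negbTE jK) !orbF eq_sym setUCA.
- by case: ifP => // _; rewrite dstep0.
- by case: ifP => // _; rewrite dstep0.
Qed.

Lemma disjoint_setU1l j J K :
  [disjoint j |: J & K] = (j \notin K) && [disjoint J & K].
Proof. by rewrite -disjointU1; apply: eq_disjoint => i; rewrite !inE. Qed.

Lemma disjoint_setU1r j J K :
  [disjoint J & j |: K] = (j \notin J) && [disjoint J & K].
Proof. by rewrite disjoint_sym disjoint_setU1l disjoint_sym. Qed.

(** Deleting [j] is a bijection between the two index families; this is why differentiating in x_j
    contracts [j]. *)
Lemma sum_extends_in (A : nmodType) K d j (f : {set 'I_n} -> A) : j \notin K ->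
  \sum_(J | extends K d.+1 J && (j \in J)) f J =
  \sum_(J | extends (j |: K) d J) f (j |: J).
Proof.
move=> jK; rewrite (reindex_onto (fun J => j |: J) (fun J => J :\ j)) /=.
  apply: eq_bigl => J; rewrite /extends setU11 andbT.
  have [jJ|jJ] := boolP (j \in J).
    have -> : ((j |: J) :\ j == J) = false.
      by apply/negP => /eqP E; move: jJ; rewrite -E !inE eqxx.
    by rewrite andbF disjoint_setU1r jJ.
  rewrite setU1K // eqxx andbT cardsU1 jJ add1n ltnS.
  by rewrite disjoint_setU1l jK disjoint_setU1r jJ /= setUCA setUA.
by move=> J /andP[_ jJ]; rewrite setD1K.
Qed.

Lemma sum_extends_in0 (A : nmodType) K d j (f : {set 'I_n} -> A) : j \in K ->
  \sum_(J | extends K d J && (j \in J)) f J = 0.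
Proof.
move=> jK; rewrite big1 // => J /andP[/and3P[dJK _ _] jJ].
by rewrite (disjointFr dJK jJ) in jK.
Qed.

(** The coefficient rule for the derivative in x_0: the exponent [e.+1] is absorbed by passing from
    [N] to [N.+1]. *)
Lemma ffact_addS N e : ((N + e.+1) ^_ N * e.+1 = (N.+1 + e) ^_ N.+1)%N.
Proof. by rewrite addSnnS ffactnSr addKn. Qed.

(** The degree [d.+1] splits into the exponent of x_0, accounted for by the derivative in x_0, and
    the size of [J], accounted for by the derivatives in x_j with [j] in [J]. *)
Lemma gen_euler (A : comNzRingType) (x : 'I_n.+1 -> A) s d :
  d.+1%:R * gen x s d.+1 = \sum_i x i * gen x (dstep i s) d.
Proof.
case: s => [[K N]|] /=; last first.
  by rewrite mulr0 big1 // => i _; rewrite mulr0.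
rewrite big_ord_recl -/(dstep _ (Some (K, N))) dstep0.
under [X in _ = _ + X]eq_bigr do rewrite -/(dstep _ (Some (K, N))) dstep_lift.
pose W J : A := ((N + (d.+1 - #|J|)) ^_ N)%:R *
      (x ord0 ^+ (d.+1 - #|J|) * \prod_(j in J) x (lift ord0 j)).
have -> : d.+1%:R * (\sum_(J | extends K d.+1 J) W J) =
    \sum_(J | extends K d.+1 J) (d.+1 - #|J|)%:R * W J
    + \sum_(J | extends K d.+1 J) #|J|%:R * W J.
  rewrite mulr_sumr -big_split; apply: eq_bigr => J /and3P[_ _ dJ] /=.
  by rewrite -mulrDl -natrD subnK.
congr (_ + _).
  rewrite /= mulr_sumr (bigID (fun J => #|J| <= d)%N) /=.
  rewrite [X in _ + X]big1 ?addr0 => [|J /andP[/and3P[_ _ h1] h2]]; last first.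
    have -> : (d.+1 - #|J| = 0)%N by apply/eqP; rewrite subn_eq0 ltnNge.
    by rewrite mul0r.
  apply: eq_big => [J|J /andP[_ dJ]].
    by rewrite /extends -!andbA; congr [&& _, _ & _]; apply: andb_idl => /leqW.
  rewrite /W subSn // -ffact_addS natrM exprS.
  by ring.
transitivity (\sum_(J | extends K d.+1 J) \sum_(j in J) W J).
  by apply: eq_bigr => J _; rewrite sumr_const mulr_natl.
rewrite (exchange_big_dep xpredT) //=; apply: eq_bigr => j _.
have [jK|jK] := boolP (j \in K); first by rewrite sum_extends_in0 ?mulr0.
rewrite sum_extends_in // mulr_sumr; apply: eq_bigr => J.
move=> /and3P[dJ _ _]; have jJ : j \notin J.
  by move: dJ; rewrite disjoint_setU1r => /andP[].
by rewrite /W cardsU1 jJ add1n subSS big_setU1 //=; ring.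
Qed.

Lemma eq_gen (A : comNzRingType) (x y : 'I_n.+1 -> A) s d :
  x =1 y -> gen x s d = gen y s d.
Proof.
move=> xy; case: s => [[K N]|] //=; apply: eq_bigr => J _; rewrite xy.
by congr (_ * (_ * _)); apply: eq_bigr.
Qed.

(** Relates the integer polynomials, their real values and their restrictions to lines, all
    instances of [gen]. *)
Lemma gen_rmorph (A B : comNzRingType) (f : {rmorphism A -> B})
    (x : 'I_n.+1 -> A) s d : f (gen x s d) = gen (f \o x) s d.
Proof.
case: s => [[K N]|] /=; last exact: rmorph0.
rewrite rmorph_sum; apply: eq_bigr => J _.
by rewrite !rmorphM rmorph_nat rmorphXn rmorph_prod.
Qed.

Section Derivation.
Variables (A : comNzRingType) (D : {additive A -> A}).
Hypothesis DM : forall u v, D (u * v) = D u * v + u * D v.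

Lemma derivation1 : D 1 = 0.
Proof.
by have /eqP := DM 1 1; rewrite !mulr1 mul1r -subr_eq0 opprD addNKr oppr_eq0 => /eqP.
Qed.

Lemma derivation_exp u e : D (u ^+ e.+1) = e.+1%:R * (D u * u ^+ e).
Proof.
elim: e => [|e IH]; first by rewrite expr1 expr0 mulr1 mul1r.
by rewrite exprS DM IH -[e.+2%:R]natr1 exprS; ring.
Qed.

Lemma derivation_prod J (y : 'I_n -> A) :
  D (\prod_(j in J) y j) = \sum_(j in J) D (y j) * \prod_(k in J :\ j) y k.
Proof.
have [m] := ubnP #|J|; elim: m J => // m IH J ltJ.
have [->|[j jJ]] := set_0Vmem J; first by rewrite !big_set0 derivation1.
rewrite !(big_setD1 j jJ) /= DM IH; last first.
  by move: ltJ; rewrite (cardsD1 j J) jJ.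
congr (_ + _); rewrite mulr_sumr; apply: eq_bigr => k.
rewrite in_setD1 => /andP[kj kJ].
rewrite [in RHS](big_setD1 j) /=; last by rewrite in_setD1 eq_sym kj.
by rewrite !setDDl setUC; ring.
Qed.

(** A chain rule for an arbitrary derivation, applied both to [mderiv] and to the derivative of
    univariate polynomials. *)
Lemma gen_derivation (x : 'I_n.+1 -> A) s d :
  D (gen x s d.+1) = \sum_i D (x i) * gen x (dstep i s) d.
Proof.
case: s => [[K N]|]; last first.
  by rewrite raddf0 big1 // => i _; rewrite mulr0.
pose c J : A := ((N + (d.+1 - #|J|)) ^_ N)%:R.
pose y j := x (lift ord0 j).
have -> : D (gen x (Some (K, N)) d.+1) =
    \sum_(J | extends K d.+1 J) c J * (D (x ord0 ^+ (d.+1 - #|J|)) * \prod_(j in J) y j)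
    + \sum_(J | extends K d.+1 J) \sum_(j in J)
        c J * (x ord0 ^+ (d.+1 - #|J|) * (D (y j) * \prod_(k in J :\ j) y k)).
  rewrite raddf_sum -big_split; apply: eq_bigr => J _ /=.
  rewrite mulr_natl raddfMn -[LHS]mulr_natl DM derivation_prod mulrDr.
  by congr (_ + _); rewrite !mulr_sumr.
rewrite big_ord_recl dstep0.
under [X in _ = _ + X]eq_bigr do rewrite dstep_lift.
congr (_ + _).
  rewrite (bigID (fun J => #|J| <= d)%N) /=.
  rewrite [X in _ + X]big1 ?addr0 => [|J /andP[/and3P[_ _ h1] h2]]; last first.
    have -> : (d.+1 - #|J| = 0)%N by apply/eqP; rewrite subn_eq0 ltnNge.
    by rewrite expr0 derivation1 mul0r mulr0.
  rewrite mulr_sumr; apply: eq_big => [J|J /andP[_ dJ]].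
    by rewrite /extends -!andbA; congr [&& _, _ & _]; apply: andb_idl => /leqW.
  rewrite /c subSn // derivation_exp -ffact_addS natrM.
  by rewrite /y; ring.
rewrite (exchange_big_dep xpredT) //=; apply: eq_bigr => j _.
have [jK|jK] := boolP (j \in K); first by rewrite sum_extends_in0 ?mulr0.
rewrite sum_extends_in // mulr_sumr; apply: eq_bigr => J.
move=> /and3P[dJ _ _]; have jJ : j \notin J.
  by move: dJ; rewrite disjoint_setU1r => /andP[].
by rewrite /c cardsU1 jJ add1n subSS setU1K // /y; ring.
Qed.

End Derivation.

End Generating.

(** * Contractions and parallel classes *)

Section Independence.
Variables (n : nat) (M : matroid n).
Local Notation F := (indep_sets M).
Implicit Types (I J K B : {set 'I_n}).

Lemma indepP I : reflect (exists2 B, B \in bases M & I \subset B) (I \in F).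
Proof.
rewrite inE; apply: (iffP existsP) => [[B /andP[]]|[B bB IB]]; exists B => //.
by rewrite bB.
Qed.

Lemma indepS I J : I \subset J -> J \in F -> I \in F.
Proof.
move=> IJ /indepP[B bB JB]; apply/indepP; exists B => //.
exact: subset_trans IJ JB.
Qed.

Lemma indep0 : set0 \in F.
Proof.
by have [B bB] := bases_neq0 M; apply/indepP; exists B => //; apply: sub0set.
Qed.

(** Among the bases containing [I], take [B1] meeting [B2] most. If no element of [J] augments [I],
    then [B1 :\: I] is contained in [B2 :\: J], and counting gives the bound. *)
Lemma indep_augment I J : I \in F -> J \in F -> (#|I| < #|J|)%N ->
  exists2 x, x \in J :\: I & x |: I \in F.
Proof.
move=> /indepP[B0 bB0 IB0] /indepP[B2 bB2 JB2] ltIJ.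
pose P B := (B \in bases M) && (I \subset B).
have PB0 : P B0 by rewrite /P bB0.
have [B1 /andP[bB1 IB1] maxB1] := arg_maxnP (fun B => #|B :&: B2|) PB0.
apply/exists_inP; apply: contraTT ltIJ; rewrite negb_exists_in => /forall_inP no.
have B1I : B1 :\: I \subset B2 :\: J.
  apply/subsetP => x; rewrite !inE => /andP[xI xB1].
  have xJ : x \notin J.
    apply/negP => xJ; have /no/negP : x \in J :\: I by rewrite inE xI.
    case; apply/indepP; exists B1 => //; apply/subsetP => z.
    by rewrite !inE => /predU1P[-> //|]; apply: (subsetP IB1).
  (* Were [x] outside [B2], exchanging it for some [y] in [B2] would give a basis containing [I] and
     meeting [B2] in more elements. *)
  rewrite xJ /=; apply/negP => /negP xB2.
  have [|y] := bases_exchange bB1 bB2 (x := x); first by rewrite inE xB2.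
  rewrite inE => /andP[yB1 yB2] bB3.
  have := maxB1 (y |: B1 :\ x); rewrite /P bB3 /= leqNgt => /implyP.
  have -> : I \subset y |: B1 :\ x.
    apply/subsetP => z zI; rewrite !inE (subsetP IB1) // andbT.
    by apply/orP; right; apply: contraNneq xI => <-.
  move=> /negP; apply; apply/proper_card/properP; split.
    apply/subsetP => z; rewrite !inE => /andP[zB1 zB2].
    rewrite zB1 zB2 !andbT; apply/orP; right.
    by apply: contraNneq xB2 => <-.
  by exists y; rewrite !inE ?eqxx // (negbTE yB1).
rewrite -leqNgt -(leq_add2r #|B2 :\: J|).
have eB : #|B1| = #|B2| by rewrite -(mrankE bB1) -(mrankE bB2).
have -> : (#|J| + #|B2 :\: J| = #|I| + #|B1 :\: I|)%N.
  by rewrite !cardsD (setIidPr JB2) (setIidPr IB1) !subnKC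
     ?subset_leq_card.
by rewrite leq_add2l subset_leq_card.
Qed.

(* The nonloops of the contraction M / K.  For active i and j, i is parallel to
   j in M / K (or equal to j) when j is not active in i |: K. *)
Definition active K : pred 'I_n := fun i => (i \notin K) && (i |: K \in F).

Lemma activeU K i j : active (i |: K) j -> active K j.
Proof.
rewrite /active in_setU1 negb_or => /andP[/andP[_ ->] /= h]; apply: (indepS _ h).
by apply: setUS; apply: subsetUr.
Qed.

Lemma activeC K i j : active K i -> active K j ->
  active (i |: K) j = active (j |: K) i.
Proof.
rewrite /active !in_setU1 !negb_or eq_sym setUCA.
by move=> /andP[-> _] /andP[-> _]; rewrite eq_sym.
Qed.

(** If [i] and [k] were independent in M / K, one of them would augment [j], against its being
    parallel to both. *)
Lemma active_trans K i j k : active K i -> active K j -> active K k ->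
  ~~ active (i |: K) j -> ~~ active (j |: K) k -> ~~ active (i |: K) k.
Proof.
move=> ai aj ak nij njk; apply/negP => aik.
have [|||x] := @indep_augment (j |: K) (k |: (i |: K)).
- by case/andP: aj.
- by case/andP: aik.
- case/andP: aj => jK _; case/andP: aik => kiK _; case/andP: ai => iK _.
  by rewrite !cardsU1 jK kiK iK.
rewrite in_setD => /andP[xj]; rewrite !in_setU1 => /or3P[] xki xF; last first.
- by rewrite in_setU1 xki orbT in xj.
- have ajx : active (j |: K) x by rewrite /active xj xF.
  by rewrite activeC // -(eqP xki) ajx in nij.
- have ajx : active (j |: K) x by rewrite /active xj xF.
  by rewrite -(eqP xki) ajx in njk.
Qed.

(* The pick depends only on the parallel class of i, so active_rep selects a
   representative of each class. *)
Definition active_rep K i :=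
  odflt i [pick j | active K j && ~~ active (i |: K) j].

Lemma active_setU1_id K i : active (i |: K) i = false.
Proof. by rewrite /active setU11. Qed.

Lemma active_repP K i : active K i ->
  active K (active_rep K i) && ~~ active (i |: K) (active_rep K i).
Proof.
rewrite /active_rep => ai; case: pickP => //= /(_ i).
by rewrite ai active_setU1_id.
Qed.

Lemma active_rep_eq K i j : active K i -> active K j ->
  (active_rep K i == active_rep K j) = ~~ active (i |: K) j.
Proof.
move=> ai aj; apply/eqP/idP => [e|nij].
  have /andP[ar nir] := active_repP ai; have /andP[_ njr] := active_repP aj.
  rewrite -e in njr; apply: active_trans nir _ => //.
  by rewrite activeC.
have e : (fun k => active K k && ~~ active (i |: K) k)
    =1 (fun k => active K k && ~~ active (j |: K) k).
  move=> k /=; case ak: (active K k) => //=; apply/idP/idP => h.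
    by apply: active_trans h => //; rewrite activeC.
  exact: active_trans nij h.
rewrite /active_rep (eq_pick e); case: pickP => // /(_ j).
by rewrite aj active_setU1_id.
Qed.

Definition class_reps K : {set 'I_n} :=
  [set active_rep K i | i in [set i | active K i]].

Lemma mem_class_reps K i : active K i -> active_rep K i \in class_reps K.
Proof. by move=> ai; apply: imset_f; rewrite inE. Qed.

Lemma card_class_reps_le K : (#|class_reps K| <= #|[set i | active K i]|)%N.
Proof. exact: leq_imset_card. Qed.

Lemma card_class_reps_lt K i j : active K i -> active K j -> i != j ->
  ~~ active (i |: K) j -> (#|class_reps K| < #|[set i | active K i]|)%N.
Proof.
move=> ai aj ij nij; rewrite ltn_neqAle card_class_reps_le andbT.
apply: contra ij => /imset_injP inj; apply/eqP/inj; rewrite ?inE //.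
by apply/eqP; rewrite active_rep_eq.
Qed.

Section ClassSums.
Variables (R : comNzRingType) (v : 'I_n -> R).

Definition active_sum K := \sum_(i | active K i) v i.

Definition class_sum K c := \sum_(i | active K i && (active_rep K i == c)) v i.

Lemma active_sum_class K : active_sum K = \sum_(c in class_reps K) class_sum K c.
Proof.
by rewrite /active_sum (partition_big (active_rep K) [in class_reps K]) //;
   exact: mem_class_reps.
Qed.

(** Contracting [i] turns exactly its parallel class into loops. *)
Lemma active_sum_setU1 K i : active K i ->
  active_sum (i |: K) = active_sum K - class_sum K (active_rep K i).
Proof.
move=> ai; apply/esym/eqP; rewrite subr_eq; apply/eqP.
rewrite /active_sum (bigID (active (i |: K))) /=; congr (_ + _).
  apply: eq_bigl => j; apply: andb_idl; exact: activeU.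
apply: eq_bigl => j; apply: andb_id2l => aj.
by rewrite active_rep_eq // activeC.
Qed.

(** The left side runs over ordered independent pairs of M / K; the pairs missing from the square of
    the sum are those inside one parallel class. *)
Lemma sum_active_pairs K :
  \sum_(i | active K i) v i * active_sum (i |: K)
  = active_sum K ^+ 2 - \sum_(c in class_reps K) class_sum K c ^+ 2.
Proof.
have -> : \sum_(i | active K i) v i * active_sum (i |: K) =
    \sum_(i | active K i) (v i * active_sum K
                           - v i * class_sum K (active_rep K i)).
  by apply: eq_bigr => i ai; rewrite active_sum_setU1 // mulrBr.
rewrite sumrB -mulr_suml -expr2; congr (_ - _).
rewrite (partition_big (active_rep K) [in class_reps K]) /=; last first.
  exact: mem_class_reps.
apply: eq_bigr => c _; rewrite expr2 {2}/class_sum mulr_suml.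
by apply: eq_bigr => i /andP[_ /eqP ->].
Qed.

End ClassSums.
End Independence.

Lemma sqr_sum_le (R : realDomainType) (I : finType) (A : {set I}) (y : I -> R) :
  (\sum_(i in A) y i) ^+ 2 <= #|A|%:R * \sum_(i in A) y i ^+ 2.
Proof.
have : 0 <= \sum_(i in A) \sum_(j in A) (y i - y j) ^+ 2.
  by apply: sumr_ge0 => i _; apply: sumr_ge0 => j _; apply: sqr_ge0.
have -> : \sum_(i in A) \sum_(j in A) (y i - y j) ^+ 2
   = 2 * (#|A|%:R * \sum_(i in A) y i ^+ 2 - (\sum_(i in A) y i) ^+ 2).
  have -> : \sum_(i in A) \sum_(j in A) (y i - y j) ^+ 2 =
      \sum_(i in A) (#|A|%:R * y i ^+ 2 + \sum_(j in A) y j ^+ 2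
                     - 2 * (y i * \sum_(j in A) y j)).
    apply: eq_bigr => i _; rewrite mulr_natl -sumr_const -big_split /=.
    rewrite !mulr_sumr -sumrB; apply: eq_bigr => j _; ring.
  rewrite sumrB big_split /= -!mulr_sumr -mulr_suml sumr_const -mulr_natl.
  by ring.
by rewrite pmulr_rge0 // subr_ge0.
Qed.

(** * The reverse Cauchy-Schwarz inequality for the Hessians *)

Section Hessians.
Variables (R : rcfType) (n : nat) (M : matroid n).
Local Notation F := (indep_sets M).
Implicit Types (a v : 'rV[R]_n.+1) (s : option ({set 'I_n} * nat)).

Definition genv a s d : R := gen F (fun i => a 0 i) s d.

(** The Hessian of a polynomial of degree [d.+2]; [d] is the degree of its entries. *)
Definition genm a s d : 'M[R]_n.+1 :=
  \matrix_(i, j) genv a (dstep i (dstep j s)) d.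

Lemma genm_sym a s d : (genm a s d)^T = genm a s d.
Proof. by apply/matrixP => i j; rewrite !mxE dstepC. Qed.

Lemma genm_step_sym a s d i j k :
  genm a (dstep i s) d j k = genm a (dstep j s) d i k.
Proof. by rewrite !mxE (dstepC k i) (dstepC j i) (dstepC j k). Qed.

Lemma genm_euler a s d i j :
  d.+1%:R * genm a s d.+1 i j = \sum_k a 0 k * genm a (dstep k s) d i j.
Proof.
rewrite mxE /genv gen_euler; apply: eq_bigr => k _; rewrite mxE.
by rewrite (dstepC k i) (dstepC k j).
Qed.

Lemma genv_ge0 a s d : (forall i, 0 <= a 0 i) -> 0 <= genv a s d.
Proof.
move=> a0; case: s => [[K N]|] //; rewrite /genv /=; apply: sumr_ge0 => J _.
by rewrite mulr_ge0 // mulr_ge0 ?exprn_ge0 // prodr_ge0.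
Qed.

Definition alive s := if s is Some (K, N) then K \in F else false.

Lemma genv_dead a s d : ~~ alive s -> genv a s d = 0.
Proof.
case: s => [[K N]|] //= KF; rewrite /genv /= big_pred0 // => J.
apply/negP => /and3P[_ h _]; case/negP: KF; apply: (indepS _ h).
exact: subsetUr.
Qed.

Lemma alive_step i s : alive (dstep i s) -> alive s.
Proof.
case: s => [[K N]|] //.
case: (unliftP ord0 i) => [j ->|->]; rewrite ?dstep_lift ?dstep0 //.
by case: ifP => // _; apply: indepS; apply: subsetUr.
Qed.

Lemma dead_step i s : ~~ alive s -> ~~ alive (dstep i s).
Proof. by apply: contra; apply: alive_step. Qed.

Lemma genm_dead a s d : ~~ alive s -> genm a s d = 0.
Proof.
by move=> ds; apply/matrixP => i j; rewrite !mxE genv_dead // !dead_step.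
Qed.

Lemma genv_gt0 a K N d J : 0 <= a 0 ord0 -> (forall i, 0 < a 0 (lift ord0 i)) ->
  extends F K d J -> (0 < a 0 ord0) || (#|J| == d) ->
  0 < genv a (Some (K, N)) d.
Proof.
move=> a0 ai KJ h; rewrite /genv /= (bigD1 J) //=; apply: ltr_pwDl.
  rewrite mulr_gt0 ?ltr0n ?ffact_gt0 ?leq_addr // mulr_gt0 ?prodr_gt0 //.
  by case/orP: h => [h|/eqP ->]; [exact: exprn_gt0 | rewrite subnn expr0].
apply: sumr_ge0 => I _; rewrite mulr_ge0 // mulr_ge0 ?exprn_ge0 // prodr_ge0 //.
by move=> i _; apply: ltW.
Qed.

Lemma extends0 K d : K \in F -> extends F K d set0.
Proof.
move=> KF; rewrite /extends cards0 set0U KF.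
by rewrite -setI_eq0 set0I eqxx.
Qed.

Lemma genv0 a K N : K \in F -> genv a (Some (K, N)) 0 = N`!%:R.
Proof.
move=> KF; rewrite /genv /= (big_pred1 set0).
  by rewrite cards0 subn0 addn0 ffactnn expr0 big_set0 !mulr1.
move=> J; rewrite /extends leqn0 cards_eq0 /=.
apply/and3P/eqP => [[_ _ /eqP //]|->].
by rewrite set0U KF -setI_eq0 set0I eqxx.
Qed.

Lemma sum_genv0 a v K N : K \in F ->
  \sum_i v 0 i * genv a (dstep i (Some (K, N))) 0 =
  v 0 ord0 * N.+1`!%:R +
  N`!%:R * active_sum M (fun j => v 0 (lift ord0 j)) K.
Proof.
move=> KF; rewrite big_ord_recl dstep0 genv0 //; congr (_ + _).
rewrite /active_sum mulr_sumr [RHS]big_mkcond; apply: eq_bigr => j _.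
rewrite dstep_lift /active; have [_|_] := boolP (j \in K); first by rewrite mulr0.
rewrite andTb; by case: ifPn => h; [rewrite genv0 // mulrC | rewrite genv_dead // mulr0].
Qed.

Lemma mulmx_genm0_ord0 a v K N : K \in F ->
  (v *m genm a (Some (K, N)) 0) 0 ord0 =
  v 0 ord0 * N.+2`!%:R +
  N.+1`!%:R * active_sum M (fun j => v 0 (lift ord0 j)) K.
Proof.
by move=> KF; rewrite -(sum_genv0 a) // mxE; apply: eq_bigr => i _; rewrite mxE dstep0.
Qed.

Lemma mulmx_genm0_lift a v K N j : K \in F ->
  (v *m genm a (Some (K, N)) 0) 0 (lift ord0 j) =
  if active M K j then v 0 ord0 * N.+1`!%:R +
     N`!%:R * active_sum M (fun j => v 0 (lift ord0 j)) (j |: K) else 0.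
Proof.
move=> KF; rewrite mxE; under eq_bigr do rewrite mxE dstep_lift.
rewrite /active; have [_|_] := boolP (j \in K).
  by rewrite big1 // => i _; rewrite mulr0.
rewrite andTb.
case: ifPn => h; first by rewrite (sum_genv0 a).
by rewrite big1 // => i _; rewrite genv_dead ?mulr0 // dead_step.
Qed.

Lemma rcs0 a : reverse_cauchy_schwarz (0 : 'M[R]_n.+1) a.
Proof. by move=> v; rewrite /bform !mulmx0 !mul0mx !mxE mul0r expr0n. Qed.

Lemma genm_rcs_base a K N : (forall i, 0 <= a 0 i) -> K \in F ->
  (#|[set i | active M K i]| <= N.+2)%N ->
  reverse_cauchy_schwarz (genm a (Some (K, N)) 0) a.
Proof.
move=> a0 KF leN; set H := genm _ _ _.
have mulH u w : bform H u w = \sum_i (u *m H) 0 i * w 0 i.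
  by rewrite /bform [LHS]mxE; apply: eq_bigr => i _; congr (_ * _); rewrite mxE.
(* The inequality is checked at the x_0 direction, where the form is positive, and moved to [a] by
   [rcs_transfer]. *)
pose e : 'rV[R]_n.+1 := delta_mx 0 ord0.
have be v : bform H e v = v 0 ord0 * N.+2`!%:R +
    N.+1`!%:R * active_sum M (fun j => v 0 (lift ord0 j)) K.
  rewrite bform_sym ?genm_sym // /bform trmx_delta -colE [LHS]mxE.
  exact: mulmx_genm0_ord0.
have ee : bform H e e = N.+2`!%:R.
  rewrite be mxE eqxx mul1r /active_sum big1 ?mulr0 ?addr0 // => j _.
  by rewrite mxE eq_sym (negbTE (neq_lift _ _)).
apply: (@rcs_transfer _ _ _ e); rewrite ?genm_sym ?ee ?ltr0n ?fact_gt0 //.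
  move=> v; rewrite ee be mulH big_ord_recl mulmx_genm0_ord0 //.
  under [X in _ + X]eq_bigr do rewrite mulmx_genm0_lift //.
  pose w j := v 0 (lift ord0 j).
  have -> : \sum_(i < n) (if active M K i
      then v 0 ord0 * N.+1`!%:R + N`!%:R * active_sum M w (i |: K) else 0) * w i
      = v 0 ord0 * N.+1`!%:R * active_sum M w K
        + N`!%:R * (\sum_(i | active M K i) w i * active_sum M w (i |: K)).
    rewrite [active_sum M w K]/active_sum !mulr_sumr -big_split /=.
    rewrite [RHS]big_mkcond; apply: eq_bigr => i _.
    by case: ifP => _; [ring | rewrite mul0r].
  rewrite sum_active_pairs -/w.
  set s := active_sum M w K.
  set Y := \sum_(c in _) _; set x := v 0 ord0.
  have sY : s ^+ 2 <= N.+2%:R * Y.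
    rewrite /s active_sum_class; apply: le_trans (sqr_sum_le _ _) _.
    apply: ler_wpM2r; first by rewrite sumr_ge0 // => c _; exact: sqr_ge0.
    by rewrite ler_nat (leq_trans (card_class_reps_le _ _)).
  rewrite !factS !natrM; set f := N`!%:R.
  have f0 : 0 <= f by exact: ler0n.
  rewrite -subr_ge0; set p := N.+1%:R; rewrite -[N.+2%:R]natr1 -/p in sY *.
  have p0 : 0 <= p by exact: ler0n.
  (* The defect is a nonnegative multiple of the Cauchy-Schwarz defect of the class sums, of which
     there are at most [N.+2]. *)
  rewrite [X in 0 <= X](_ : _ = p * (f ^+ 2 * ((p + 1) * Y - s ^+ 2))); last by ring.
  by rewrite mulr_ge0 // mulr_ge0 ?sqr_ge0 // subr_ge0.
rewrite bformE sumr_ge0 // => i _; rewrite sumr_ge0 // => j _.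
by rewrite !mulr_ge0 // mxE genv_ge0.
Qed.

Definition ample s d :=
  if s is Some (K, N) then (#|[set i | active M K i]| <= N + d)%N else true.

(** The degree drops by one, which is made up for by the increase of [N] for x_0, or by the loss of
    the nonloop [j] for x_j. *)
Lemma ample_step i s d : ample s d.+1 -> ample (dstep i s) d.
Proof.
case: s => [[K N]|] //=.
rewrite -/(dstep i (Some (K, N))).
case: (unliftP ord0 i) => [j ->|->]; rewrite ?dstep_lift ?dstep0; last first.
  by rewrite /= addSnnS.
case: ifPn => // jK; rewrite /= addnS => h.
have [jF|jF] := boolP (j |: K \in F); last first.
  rewrite (_ : [set _ | _] = set0) ?cards0 //.
  apply/setP => k; rewrite inE [RHS]inE; apply/negP => /andP[_ kF].
  by case/negP: jF; apply: (indepS _ kF); apply: subsetUr.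
rewrite -ltnS; apply: leq_trans h; apply: proper_card; apply/properP; split.
  by apply/subsetP => k; rewrite !inE; apply: activeU.
by exists j; rewrite inE ?active_setU1_id // /active jK jF.
Qed.

Lemma genm_rcs_pos a s d : (forall i, 0 < a 0 i) -> ample s d.+2 ->
  reverse_cauchy_schwarz (genm a s d) a.
Proof.
move=> a0; have a0' i : 0 <= a 0 i by apply: ltW.
elim: d s => [|d IH] s amp.
  have [|ds] := boolP (alive s); last by rewrite genm_dead //; apply: rcs0.
  case: s amp => [[K N]|] //= amp KF.
  by apply: genm_rcs_base; rewrite // -addn2.
apply: (@local_to_global _ _ _ (fun k => genm a (dstep k s) d) a ord0 d.+1%:R).
- by rewrite ltr0n.
- exact: a0.
- by move=> k; apply: genm_sym.
- by move=> i j k; apply: genm_step_sym.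
- by move=> i j k; rewrite mxE genv_ge0.
- exact: genm_euler.
- by move=> k; apply: IH; apply: ample_step.
(* [ord0] serves as the adjacent index: if row [i] is nonzero, the entry at [ord0] contains a
   positive multiple of a power of x_0, the term of the empty set. *)
move=> i h; have al : alive (dstep i s).
  apply: contraNT h => ds; rewrite mxE big1 // => k _.
  by rewrite mxE genv_dead ?mulr0 // dead_step.
rewrite mxE; case: (dstep i s) al => [[K N]|] //= KF.
rewrite -/(dstep ord0 (Some (K, N))) dstep0.
by apply: genv_gt0 (extends0 _ KF) _; rewrite ?a0.
Qed.

Lemma poly_ge0_at0 (p : {poly R}) : (forall t, 0 < t -> 0 <= p.[t]) -> 0 <= p.[0].
Proof.
move=> h; rewrite leNgt; apply/negP => p0.
have p0' : 0 < - p.[0] by rewrite oppr_gt0.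
have [e e0 he] := poly_cont 0 p p0'.
have := he (e / 2); rewrite subr0 gtr0_norm ?divr_gt0 // => /(_ _)/ltr_normlW.
have : e / 2 < e by lra.
by move=> -> /(_ isT); have := h (e / 2); rewrite divr_gt0 // => /(_ isT); lra.
Qed.

Lemma genm_rcs a s d : 0 <= a 0 ord0 -> (forall i, 0 < a 0 (lift ord0 i)) ->
  ample s d.+2 -> reverse_cauchy_schwarz (genm a s d) a.
Proof.
move=> a0 ai amp v.
(* Only the coordinate of index 0 is moved, to [a_0 + t]; the defect is then a polynomial in [t],
   nonnegative for [t > 0] and hence at 0. *)
pose x i : {poly R} := (a 0 i)%:P + (i == ord0)%:R *: 'X.
pose c i : {poly R} := (v 0 i)%:P.
pose b (u w : 'I_n.+1 -> {poly R}) := \sum_i \sum_j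
  u i * gen F x (dstep i (dstep j s)) d * w j.
pose at_ t (u : 'I_n.+1 -> {poly R}) : 'rV[R]_n.+1 := \row_i (u i).[t].
have bE t u w : (b u w).[t] = bform (genm (at_ t x) s d) (at_ t u) (at_ t w).
  rewrite bformE horner_sum; apply: eq_bigr => i _.
  rewrite horner_sum; apply: eq_bigr => j _.
  rewrite !hornerM !mxE; congr (_ * _ * _).
  rewrite -[LHS]/(horner_eval t _) gen_rmorph /genv.
  by apply: eq_gen => k; rewrite mxE.
have x0 : at_ 0 x = a.
  by apply/rowP => i; rewrite !mxE !hornerE ?mulr0 ?addr0.
have cE t : at_ t c = v by apply/rowP => i; rewrite !mxE hornerC.
have := @poly_ge0_at0 (b x c ^+ 2 - b x x * b c c).
rewrite !hornerE !bE x0 !cE subr_ge0; apply => t t0.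
rewrite !hornerE !bE !cE subr_ge0; apply: genm_rcs_pos => // i.
rewrite !mxE !hornerE; case: (unliftP ord0 i) => [j ->|->].
  by rewrite eq_sym (negbTE (neq_lift _ _)) mul0r addr0.
by rewrite eqxx mul1r; apply: ltr_wpDl.
Qed.

End Hessians.

(** * Kernels of the Hessians *)

Section Rank.
Variables (n : nat) (M : matroid n).
Local Notation F := (indep_sets M).
Implicit Types (I J K B : {set 'I_n}).

Lemma exists_extends K d : K \in F -> (#|K| + d <= mrank M)%N ->
  exists2 J, extends F K d J & #|J| = d.
Proof.
elim: d => [|d IH] KF ler.
  by exists set0; rewrite ?cards0 //; apply: extends0.
have [|J /and3P[dJK JKF Jd] cJ] := IH KF; first by apply: leq_trans ler; rewrite addnS.
have [B bB] := bases_neq0 M.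
have BF : B \in F by apply/indepP; exists B.
have cJK : #|J :|: K| = (#|K| + d)%N.
  by rewrite cardsU (disjoint_setI0 dJK) cards0 subn0 cJ addnC.
have [|x] := indep_augment JKF BF; first by rewrite cJK -(mrankE bB) -addnS.
rewrite in_setD in_setU negb_or => /andP[/andP[xJ xK] _] xF.
exists (x |: J); last by rewrite cardsU1 xJ cJ.
by rewrite /extends disjoint_setU1l xK dJK -setUA xF cardsU1 xJ cJ leqnn.
Qed.

Lemma active_exists K : K \in F -> (#|K| < mrank M)%N -> exists i, active M K i.
Proof.
rewrite -addn1 => KF /(exists_extends KF)[J /and3P[dJK JKF _]] /eqP/cards1P[i Ji].
exists i; rewrite Ji in dJK JKF; rewrite /active JKF andbT.
by rewrite disjoints1 in dJK.
Qed.

Lemma card_class_reps_gt1 K : K \in F -> (#|K|.+1 < mrank M)%N ->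
  (1 < #|class_reps M K|)%N.
Proof.
move=> KF ltr; have [i ai] := active_exists KF (ltnW ltr).
have [|j aij] := active_exists (proj2 (andP ai)).
  by case/andP: ai => iK _; rewrite cardsU1 iK.
have aj := activeU aij; apply/card_gt1P.
exists (active_rep M K i), (active_rep M K j).
by rewrite !mem_class_reps // active_rep_eq // negbK aij.
Qed.

End Rank.

Section Kernel.
Variables (R : rcfType) (n : nat) (M : matroid n) (a : 'rV[R]_n.+1).
Hypotheses (a0 : 0 <= a 0 ord0) (ai : forall i, 0 < a 0 (lift ord0 i)).
Local Notation F := (indep_sets M).
Implicit Types (K : {set 'I_n}) (v : 'rV[R]_n.+1).

Let a_ge0 i : 0 <= a 0 i.
Proof. by case: (unliftP ord0 i) => [j ->|->] //; apply: ltW. Qed.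

Lemma bform_genm s d : bform (genm M a s d) a a = (d.+2 * d.+1)%:R * genv M a s d.+2.
Proof.
rewrite bformE natrM [d.+2%:R * _]mulrC -mulrA /genv gen_euler mulr_sumr.
apply: eq_bigr => i _; rewrite mulrCA gen_euler mulr_sumr.
by apply: eq_bigr => j _; rewrite mxE /genv (dstepC i j); ring.
Qed.

Lemma bform_genm_gt0 K N d : K \in F -> (#|K| + d.+2 <= mrank M)%N ->
  0 < bform (genm M a (Some (K, N)) d) a a.
Proof.
move=> KF /(exists_extends KF)[J eJ cJ]; rewrite bform_genm mulr_gt0 ?ltr0n //.
by apply: genv_gt0 eJ _; rewrite // cJ eqxx orbT.
Qed.

(** A kernel vector is orthogonal to [a] for every [T k], so each [bform (T k) v v] is nonpositive,
    while their sum weighted by [a] is 0. The weight of x_j is positive, so [v] is isotropic for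
    that derivative, hence in its kernel. *)
Lemma genm_ker_step K N d j v : j |: K \in F -> j \notin K ->
  (#|K| + d.+3 <= mrank M)%N -> ample M (Some (K, N)) d.+3 ->
  v *m genm M a (Some (K, N)) d.+1 = 0 -> v *m genm M a (Some (j |: K, N)) d = 0.
Proof.
move=> jKF jK ler amp vH; set s := Some (K, N).
have KF : K \in F by apply: (indepS _ jKF); apply: subsetUr.
pose T k := genm M a (dstep k s) d.
have T_rcs k : reverse_cauchy_schwarz (T k) a.
  by apply: genm_rcs => //; apply: ample_step.
have aT k : bform (T k) a v = 0.
  rewrite -(@tensor_mulmx _ _ (genm M a s d.+1) T a d.+1%:R).
  - by rewrite vH mxE mulr0.
  - by move=> i; apply: genm_sym.
  - by move=> i i' i''; apply: genm_step_sym.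
  - exact: genm_euler.
have T_gt0 k : alive M (dstep k s) -> 0 < bform (T k) a a.
  rewrite /T /s; case: (unliftP ord0 k) => [i ->|->].
    rewrite dstep_lift; case: ifPn => //= iK iKF; apply: bform_genm_gt0 => //.
    by rewrite cardsU1 iK add1n addSnnS.
  rewrite dstep0 /= => _; apply: bform_genm_gt0 => //.
  by apply: leq_trans ler; rewrite leq_add2l.
have T_le0 k : bform (T k) v v <= 0.
  have [al|ds] := boolP (alive M (dstep k s)); last first.
    by rewrite /T genm_dead // /bform mulmx0 mul0mx mxE.
  exact: rcs_orth_le0 (T_gt0 _ al) (T_rcs k) (aT k).
have sum0 : \sum_k - (a 0 k * bform (T k) v v) = 0.
  rewrite sumrN -(@tensor_bform _ _ (genm M a s d.+1) T a d.+1%:R).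
    by rewrite /bform vH mul0mx mxE mulr0 oppr0.
  exact: genm_euler.
have Tj : T (lift ord0 j) = genm M a (Some (j |: K, N)) d.
  by rewrite /T /s dstep_lift (negbTE jK).
rewrite -Tj; apply: (rcs_isotropic (a := a)) => //.
- exact: genm_sym.
- by apply: T_gt0; rewrite /s dstep_lift (negbTE jK).
have /eqP := sum0; rewrite psumr_eq0; last first.
  by move=> k _; rewrite -mulrN mulr_ge0 // oppr_ge0.
move=> /allP/(_ (lift ord0 j) (mem_index_enum _)).
by rewrite oppr_eq0 mulf_eq0 (gt_eqF (ai j)) => /eqP.
Qed.

Lemma genm_ker_quadratic K N d v : K \in F -> (#|K| + d.+2 <= mrank M)%N ->
  ample M (Some (K, N)) d.+2 -> v *m genm M a (Some (K, N)) d = 0 ->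
  forall K', K \subset K' -> K' \in F -> #|K'| = (#|K| + d)%N ->
  v *m genm M a (Some (K', N)) 0 = 0.
Proof.
elim: d K => [|d IH] K KF ler amp vH K' KK' K'F cK'.
  suff <- : K = K' by [].
  by apply/eqP; rewrite eqEcard KK' cK' addn0 leqnn.
have [j jK' jK] : exists2 j, j \in K' & j \notin K.
  apply/subsetPn; apply/negP => /subset_leq_card.
  by rewrite cK' -[leqRHS]addn0 leq_add2l.
have sub : j |: K \subset K' by rewrite subUset sub1set jK' KK'.
have jKF : j |: K \in F by apply: indepS K'F.
apply: (IH (j |: K)) => //.
- by rewrite cardsU1 jK add1n addSnnS.
- have := ample_step (lift ord0 j) amp.
  by rewrite dstep_lift (negbTE jK).
- exact: genm_ker_step vH.
- by rewrite cardsU1 jK add1n addSnnS.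
Qed.

Hypothesis simpleM : simple_matroid M.
Hypothesis rank2 : (2 <= mrank M)%N.

(* Descending induction on K: the vanishing of the sums for M / (K + i) makes all
   class sums of M / K equal to the sum over its nonloops, which is then 0 as
   there are at least two classes. *)
Lemma active_sum_eq0 (v : 'I_n -> R) :
  (forall K, K \in F -> #|K|.+1 = mrank M -> active_sum M v K = 0) ->
  forall i, v i = 0.
Proof.
move=> base.
have desc m K : K \in F -> (#|K| + m).+1 = mrank M -> active_sum M v K = 0.
  elim: m K => [|m IH] K KF cK; first by apply: base; rewrite // -cK addn0.
  have ys i : active M K i -> class_sum M v K (active_rep M K i) = active_sum M v K.
    move=> act; have := active_sum_setU1 v act.
    rewrite IH; last 2 first.
    - by case/andP: act.
    - by case/andP: act => iK _; rewrite -cK cardsU1 iK addSnnS.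
    by move/esym/eqP; rewrite subr_eq0 => /eqP.
  have : active_sum M v K = #|class_reps M K|%:R * active_sum M v K.
    rewrite {1}active_sum_class mulr_natl -sumr_const; apply: eq_bigr => c.
    by case/imsetP => i; rewrite inE => act ->; apply: ys.
  have lt1 : (1 < #|class_reps M K|)%N.
    by apply: card_class_reps_gt1 => //; rewrite -cK addnS !ltnS leq_addr.
  move/eqP; rewrite -subr_eq0 -{1}[active_sum M v K]mul1r -mulrBl mulf_eq0.
  by rewrite subr_eq0 eq_sym pnatr_eq1 (gtn_eqF lt1) => /eqP.
move=> i; have i0 : active M set0 i.
  rewrite /active in_set0 setU0.
  by have := simpleM.1 i; rewrite /is_loop negbK.
have h0 : active_sum M v set0 = 0.
  by apply: (desc (mrank M).-1); rewrite ?indep0 // cards0 add0n prednK // ltnW.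
have hi : active_sum M v (i |: set0) = 0.
  apply: (desc (mrank M).-2); first by case/andP: i0.
  by rewrite setU0 cards1; case: (mrank M) rank2 => [|[]].
(* In a simple matroid the class of [i] is [i] alone, so [v i] is the difference of two vanishing
   sums. *)
have := active_sum_setU1 v i0; rewrite h0 hi sub0r => /esym/eqP.
rewrite oppr_eq0 /class_sum (big_pred1 i) => [/eqP //|j].
have aj : active M set0 j.
  rewrite /active in_set0 setU0.
  by have := simpleM.1 j; rewrite /is_loop negbK.
rewrite aj active_rep_eq //= /active setU0 in_set1.
have := simpleM.2 i j; rewrite /are_parallel (simpleM.1 i) (simpleM.1 j) /=.
rewrite negb_and !negbK setUC.
by rewrite [j == i]eq_sym; case: (i == j) => //= ->.
Qed.

Lemma genm_ker_trivial N v : (n <= N + mrank M)%N ->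
  (exists K, [/\ K \in F, #|K|.+2 = mrank M & (#|class_reps M K| < N.+2)%N]) ->
  v *m genm M a (Some (set0, N)) (mrank M).-2 = 0 -> v = 0.
Proof.
move=> leN [K0 [K0F cK0 ltK0]] vH.
have r2 : (mrank M).-2.+2 = mrank M by case: (mrank M) rank2 => [|[]].
have quad K : K \in F -> #|K|.+2 = mrank M -> v *m genm M a (Some (K, N)) 0 = 0.
  move=> KF cK; apply: (genm_ker_quadratic _ _ _ vH) => //.
  - exact: indep0.
  - by rewrite cards0 r2.
  - rewrite /= r2; apply: leq_trans leN.
    by rewrite -[leqRHS]card_ord max_card.
  - exact: sub0set.
  - by rewrite cards0 add0n -cK.
pose w j := v 0 (lift ord0 j).
(* The x_0 row and the x_i rows of the quadratic Hessians express the sums over M / K and M / (K +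
   i) through v_0, with factors [N.+2] and [N.+1]. *)
have row0 K : K \in F -> #|K|.+2 = mrank M ->
    active_sum M w K = - (N.+2%:R * v 0 ord0).
  move=> KF cK; have := mulmx_genm0_ord0 a v N KF; rewrite quad // mxE -/w.
  rewrite factS natrM => e.
  have f0 : N.+1`!%:R != 0 :> R by rewrite pnatr_eq0 -lt0n fact_gt0.
  apply: (mulfI f0); rewrite mulrN; apply/eqP; rewrite -addr_eq0.
  by apply/eqP; rewrite [RHS]e; ring.
have rowi K i : K \in F -> #|K|.+2 = mrank M -> active M K i ->
    active_sum M w (i |: K) = - (N.+1%:R * v 0 ord0).
  move=> KF cK act; have := mulmx_genm0_lift a v N i KF; rewrite quad // mxE act -/w.
  rewrite factS natrM => e.
  have f0 : N`!%:R != 0 :> R by rewrite pnatr_eq0 -lt0n fact_gt0.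
  apply: (mulfI f0); rewrite mulrN; apply/eqP; rewrite -addr_eq0.
  by apply/eqP; rewrite [RHS]e; ring.
(* Each class sum of M / K0 is a difference of these sums, namely -v_0, and they add up to -(N+2)
   v_0; with fewer than N+2 classes, v_0 is 0. *)
have v00 : v 0 ord0 = 0.
  have := row0 _ K0F cK0; rewrite active_sum_class.
  rewrite (eq_bigr (fun=> - v 0 ord0)); last first.
    move=> c /imsetP[j]; rewrite inE => act ->.
    have := active_sum_setU1 w act; rewrite rowi // row0 //.
    by rewrite -[N.+2%:R]natr1; lra.
  rewrite sumr_const -[- _ *+ _]mulr_natl mulrN => /oppr_inj/eqP.
  rewrite -subr_eq0 -mulrBl mulf_eq0 subr_eq0 eqr_nat.
  by rewrite (ltn_eqF ltK0) => /eqP.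
have w0 : forall i, w i = 0.
  apply: active_sum_eq0 => K KF cK.
  have [i iK] : exists i, i \in K.
    by apply/set0Pn; rewrite -card_gt0; move: rank2; rewrite -cK ltnS.
  have KE : i |: (K :\ i) = K by rewrite setD1K.
  have act : active M (K :\ i) i by rewrite /active KE KF setD11.
  have := @rowi (K :\ i) i; rewrite KE v00 mulr0 oppr0; apply=> //.
    by apply: indepS KF; apply: subD1set.
  by rewrite -cK (cardsD1 i K) iK.
apply/rowP => i; rewrite mxE.
by case: (unliftP ord0 i) => [j ->|->] //; apply: w0.
Qed.

End Kernel.

(** * Rank 2 contractions of nonuniform matroids *)

Section Uniform.
Variables (n : nat) (M : matroid n).
Local Notation F := (indep_sets M).

Lemma mrank_le : (mrank M <= n)%N.
Proof.
have [B bB] := bases_neq0 M.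
by rewrite (mrankE bB) -[leqRHS]card_ord max_card.
Qed.

Lemma basesE B : (B \in bases M) = (B \in F) && (#|B| == mrank M).
Proof.
apply/idP/andP => [bB|[/indepP[B' bB' BB']] /eqP cB].
  by rewrite -(mrankE bB) eqxx; split=> //; apply/indepP; exists B.
suff -> : B = B' by [].
by apply/eqP; rewrite eqEcard BB' cB (mrankE bB') leqnn.
Qed.

(** Otherwise each contraction by an independent set of size r - 2 has as many classes as elements,
    so it has neither loops nor parallel pairs. Single exchanges are then unrestricted, and they
    connect a basis to every r-subset. *)
Lemma exists_few_classes : (2 <= mrank M)%N -> ~ uniform_matroid M ->
  exists K, [/\ K \in F, #|K|.+2 = mrank M
    & (#|class_reps M K| < (n - mrank M).+2)%N].
Proof.
move=> r2 nonunif.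
pose P K := [&& K \in F, #|K|.+2 == mrank M
    & (#|class_reps M K| < (n - mrank M).+2)%N].
have [/existsP[K /and3P[h1 /eqP h2 h3]]|] := boolP [exists K, P K].
  by exists K.
rewrite negb_exists => /forallP many; case: nonunif.
have cact K : K \in F -> #|K|.+2 = mrank M ->
    (#|[set i | active M K i]| <= #|class_reps M K|)%N /\
    forall i, i \notin K -> active M K i.
  move=> KF cK; have := many K; rewrite /P KF cK eqxx /= -leqNgt => le1.
  have sub : [set i | active M K i] \subset setC K.
    by apply/subsetP => i; rewrite !inE => /andP[].
  have cC : #|setC K| = (n - mrank M).+2.
    have := cardsC K; rewrite card_ord -cK => e.
    have := mrank_le; rewrite -cK => le2.
    by apply/eqP; rewrite -(eqn_add2l #|K|) e -addSnnS -addSnnS subnKC.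
  have := card_class_reps_le M K => le2.
  have eqs : [set i | active M K i] = setC K.
    by apply/eqP; rewrite eqEcard sub cC (leq_trans le1 le2).
  split; first by rewrite eqs cC.
  by move=> i; rewrite -in_setC -eqs inE.
(* Contract [B] without [x] and a second element [z]: there [z] and [y] are not parallel, so [y] can
   take the place of [x]. *)
have swap B x y : B \in bases M -> x \in B -> y \notin B -> y |: B :\ x \in bases M.
  move=> bB xB yB; have cB := mrankE bB.
  have [z zB] : exists z, z \in B :\ x.
    apply/set0Pn; rewrite -card_gt0; move: r2.
    by rewrite cB (cardsD1 x) xB ltnS.
  pose K := (B :\ x) :\ z.
  have zK : z |: K = B :\ x by rewrite setD1K.
  have BF : B \in F by move: bB; rewrite basesE => /andP[].
  have BxF : B :\ x \in F by apply: indepS BF; apply: subD1set.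
  have KF : K \in F by apply: indepS BxF; apply: subD1set.
  have cK : #|K|.+2 = mrank M.
    by rewrite cB (cardsD1 x B) xB (cardsD1 z (B :\ x)) zB.
  have [le actK] := cact _ KF cK.
  have yBx : y \notin B :\ x by rewrite in_setD1 (negbTE yB) andbF.
  have ay : active M K y.
    by apply: actK; rewrite in_setD1 (negbTE yBx) andbF.
  have az : active M K z by apply: actK; rewrite setD11.
  have zy : z != y by apply: contraNneq yBx => <-.
  have azy : active M (z |: K) y.
    by apply: contraLR le => nzy; rewrite -ltnNge; apply: card_class_reps_lt nzy.
  rewrite basesE; case/andP: azy; rewrite zK => _ -> /=.
  by rewrite cardsU1 yBx cB (cardsD1 x B) xB.
have all_bases m (B C : {set 'I_n}) : B \in bases M -> #|C| = mrank M -> #|C :\: B| = m ->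
    C \in bases M.
  elim: m B => [|m IH] B bB cC cm.
    have /eqP := cm; rewrite cards_eq0 setD_eq0 => CB.
    suff -> : C = B by [].
    by apply/eqP; rewrite eqEcard CB cC (mrankE bB) leqnn.
  have [y yCB] : exists y, y \in C :\: B by apply/set0Pn; rewrite -card_gt0 cm.
  have [x xBC] : exists x, x \in B :\: C.
    apply/set0Pn; rewrite -card_gt0 cardsD setIC.
    by rewrite -(mrankE bB) -cC -cardsD cm.
  move: yCB xBC; rewrite !in_setD => /andP[yB yC] /andP[xC xB].
  apply: (IH (y |: B :\ x)) => //; first exact: swap.
  have -> : C :\: (y |: B :\ x) = (C :\: B) :\ y.
    apply/setP => k; rewrite !inE negb_or negb_and negbK -andbA; congr (_ && _).
    by case: eqVneq => [->|//]; rewrite (negbTE xC) !andbF.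
  have := cardsD1 y (C :\: B).
  by rewrite cm in_setD yB yC => -[].
exists (mrank M); split; first exact: mrank_le.
have [B bB] := bases_neq0 M.
apply/setP => C; rewrite inE; apply/idP/eqP => [bC|cC].
  by rewrite -(mrankE bC).
exact: all_bases bB cC erefl.
Qed.

End Uniform.

(** * The Hessians of the matroid polynomials *)

Section Linking.
Variables (R : realType) (n : nat) (M : matroid n).
Local Notation F := (indep_sets M).

Definition mgen m (x : 'I_n.+1 -> mpoly m int) s d : mpoly m int :=
  @gen n F (mpoly m int) x s d.

Lemma poly_at_mgen m (x : 'I_n.+1 -> mpoly m int) s d (a : 'rV[R]_m) :
  poly_at (mgen x s d) a = gen F (fun k => poly_at (x k) a) s d.
Proof.
rewrite /poly_at /mgen (gen_rmorph _ (map_mpoly intr)).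
by rewrite (gen_rmorph _ (meval (fun i => a ord0 i))).
Qed.

Lemma mderiv_mgen m i (x : 'I_n.+1 -> mpoly m int) s d :
  mderiv i (mgen x s d.+1) = \sum_k mderiv i (x k) * mgen x (dstep k s) d.
Proof. exact: (@gen_derivation _ F _ (mderiv i) (mderivM i)). Qed.

Lemma mderiv_mvar m (i j : 'I_m) : mderiv i (mvar j) = (j == i)%:R.
Proof.
rewrite /mvar mderivX mnm1E; case: eqVneq => [->|_]; last by rewrite scale0r.
rewrite scale1r -mpolyX0; congr (mpolyX _ _).
by apply/mnmP => l; rewrite mnmBE mnm0E subnn.
Qed.

Lemma poly_at_mvar m (i : 'I_m) (a : 'rV[R]_m) : poly_at (mvar i) a = a 0 i.
Proof. by rewrite /poly_at /mvar map_mpolyX mevalXU. Qed.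

Lemma mderiv_mgen_mvar i s d :
  mderiv i (mgen (@mvar n.+1) s d.+1) = mgen (@mvar n.+1) (dstep i s) d.
Proof.
rewrite mderiv_mgen (bigD1 i) //= big1 => [|k ki].
  by rewrite mderiv_mvar eqxx mul1r addr0.
by rewrite mderiv_mvar (negbTE ki) mul0r.
Qed.

(** The independent set polynomial is g(set0, 0, n), and each derivative in x_0 moves one unit from
    the degree to [N]. *)
Lemma hessian_at_reduced_indep_poly (a : 'rV[R]_n.+1) : (2 <= mrank M)%N ->
  hessian_at (reduced_indep_poly M) a =
  genm M a (Some (set0, n - mrank M)%N) (mrank M).-2.
Proof.
move=> r2.
have indepE : indep_poly M = mgen (@mvar n.+1) (Some (set0, 0%N)) n.
  rewrite /indep_poly /=; apply: eq_big => [J|J _].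
    rewrite /extends setU0 -setI_eq0 setI0 eqxx.
    by rewrite -[X in (_ <= X)%N]card_ord max_card andbT.
  by rewrite ffactn0 mul1r mulrC.
have it k : (k <= n)%N -> iter k (mderiv ord0) (indep_poly M) =
    mgen (@mvar n.+1) (Some (set0, k)) (n - k).
  elim: k => [|k IH] kn; first by rewrite subn0.
  rewrite iterS IH; last exact: ltnW.
  rewrite -(subnSK kn) mderiv_mgen_mvar dstep0; reflexivity.
have rn := mrank_le M.
have r22 : (mrank M).-2.+2 = mrank M by case: (mrank M) r2 => [|[]].
rewrite /reduced_indep_poly it ?leq_subr // subKn // -{2}r22.
apply/matrixP => i j; rewrite !mxE !mderiv_mgen_mvar poly_at_mgen; apply: eq_gen => k.
exact: poly_at_mvar.
Qed.

(** Embeds the space of the x_i as the hyperplane x_0 = 0. *)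
Definition pad (u : 'rV[R]_n) : 'rV[R]_n.+1 :=
  \row_k (if unlift ord0 k is Some j then u 0 j else 0).

Lemma pad0 u : pad u 0 ord0 = 0.
Proof. by rewrite mxE unlift_none. Qed.

Lemma pad_lift u j : pad u 0 (lift ord0 j) = u 0 j.
Proof. by rewrite mxE liftK. Qed.

Lemma sum_pad u (f : 'I_n.+1 -> R) :
  \sum_k pad u 0 k * f k = \sum_j u 0 j * f (lift ord0 j).
Proof.
rewrite big_ord_recl pad0 mul0r add0r.
by apply: eq_bigr => j _; rewrite pad_lift.
Qed.

Lemma pad_eq0 u : (pad u == 0) = (u == 0).
Proof.
apply/eqP/eqP => [/rowP h|->].
  by apply/rowP => j; have := h (lift ord0 j); rewrite pad_lift !mxE.
by apply/rowP => k; rewrite !mxE; case: unlift => // j; rewrite mxE.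
Qed.

Lemma basis_polyE (x : 'I_n.+1 -> mpoly n int) :
  x ord0 = 0 -> (forall j, x (lift ord0 j) = mvar j) ->
  basis_poly M = mgen x (Some (set0, 0%N)) (mrank M).
Proof.
move=> x0 xl; rewrite /mgen /= [RHS](bigID (fun J : {set 'I_n} => #|J| == mrank M)) /=.
rewrite [X in _ + X]big1 ?addr0; last first.
  move=> J /andP[/and3P[_ _ le] ne].
  by rewrite x0 expr0n subn_eq0 leqNgt ltn_neqAle ne le mul0r mulr0.
apply: eq_big => [J|J bJ].
  rewrite basesE /extends setU0 -setI_eq0 setI0 eqxx /=.
  by rewrite -andbA; congr (_ && _); case: eqP => [->|]; rewrite ?leqnn ?andbF.
rewrite ffactn0 mul1r (mrankE bJ) subnn expr0 mul1r.
by apply: eq_bigr => j _; rewrite xl.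
Qed.

Let y (k : 'I_n.+1) : mpoly n int :=
  if unlift ord0 k is Some j then mvar j else 0.

Let y0 : y ord0 = 0. Proof. by rewrite /y unlift_none. Qed.

Let y_lift j : y (lift ord0 j) = mvar j. Proof. by rewrite /y liftK. Qed.

Let poly_at_y k (a : 'rV[R]_n) : poly_at (y k) a = pad a 0 k.
Proof.
rewrite /y mxE; case: unlift => [j|]; first exact: poly_at_mvar.
by rewrite /poly_at !raddf0.
Qed.

Let mderiv_mgen_y l s d :
  mderiv l (mgen y s d.+1) = mgen y (dstep (lift ord0 l) s) d.
Proof.
rewrite mderiv_mgen (bigD1 (lift ord0 l)) //= big1 => [|k ki].
  by rewrite y_lift mderiv_mvar eqxx mul1r addr0.
case: (unliftP ord0 k) ki => [m ->|-> _]; last by rewrite y0 raddf0 mul0r.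
by rewrite (inj_eq lift_inj) y_lift mderiv_mvar => /negbTE ->; rewrite mul0r.
Qed.

Lemma poly_at_basis_poly (a : 'rV[R]_n) :
  poly_at (basis_poly M) a = genv M (pad a) (Some (set0, 0%N)) (mrank M).
Proof.
rewrite (basis_polyE y0 y_lift) poly_at_mgen; apply: eq_gen => k.
exact: poly_at_y.
Qed.

Lemma hessian_at_basis_poly (a : 'rV[R]_n) i j : (2 <= mrank M)%N ->
  hessian_at (basis_poly M) a i j = genv M (pad a)
    (dstep (lift ord0 i) (dstep (lift ord0 j) (Some (set0, 0%N))))
    (mrank M).-2.
Proof.
move=> r2; have r22 : (mrank M).-2.+2 = mrank M by case: (mrank M) r2 => [|[]].
rewrite !mxE (basis_polyE y0 y_lift) -{1}r22 !mderiv_mgen_y poly_at_mgen.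
by apply: eq_gen => k; apply: poly_at_y.
Qed.

(** At x_0 = 0 only the sets of size exactly [d] survive, all with coefficient [N!]; hence the
    freedom to choose [N] for the basis polynomial. *)
Lemma genv_shift (a : 'rV[R]_n.+1) K N d : a 0 ord0 = 0 ->
  genv M a (Some (K, N)) d = N`!%:R * genv M a (Some (K, 0%N)) d :> R.
Proof.
move=> a0; rewrite /genv /= mulr_sumr; apply: eq_bigr => J /and3P[_ _ le].
rewrite ffactn0 mul1r a0 expr0n subn_eq0.
case: leqP => h; last by rewrite mul0r !mulr0.
by have /eqP -> : #|J| == d; [rewrite eqn_leq le h | rewrite subnn addn0 ffactnn].
Qed.

Lemma genv_step_shift (a : 'rV[R]_n.+1) N d i j : a 0 ord0 = 0 ->
  genv M a (dstep (lift ord0 i) (dstep (lift ord0 j) (Some (set0, N)))) d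
  = N`!%:R * genv M a
      (dstep (lift ord0 i) (dstep (lift ord0 j) (Some (set0, 0%N)))) d :> R.
Proof.
move=> a0; rewrite !dstep_lift in_set0 !dstep_lift.
by case: ifP => _; [rewrite mulr0 | apply: genv_shift].
Qed.

Lemma bform_hessian_basis z u w : (2 <= mrank M)%N ->
  bform (genm M (pad z) (Some (set0, n)) (mrank M).-2) (pad u) (pad w)
  = n`!%:R * bform (hessian_at (basis_poly M) z) u w.
Proof.
move=> r2; rewrite !bformE mulr_sumr.
under eq_bigr => i _ do (under eq_bigr => j _ do rewrite -mulrA).
under eq_bigr => i _ do rewrite -mulr_sumr.
rewrite sum_pad; apply: eq_bigr => i _.
under eq_bigr => j _ do rewrite mulrC.
rewrite sum_pad !mulr_sumr; apply: eq_bigr => j _.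
rewrite hessian_at_basis_poly // mxE genv_step_shift ?pad0 //.
by ring.
Qed.

(** Reverse Cauchy-Schwarz gives nonpositivity on the hyperplane; equality would put [v] in the
    kernel, which is trivial. *)
Lemma genm_hyperplane (a : 'rV[R]_n.+1) N : simple_matroid M -> (2 <= mrank M)%N ->
  0 <= a 0 ord0 -> (forall i, 0 < a 0 (lift ord0 i)) -> (n <= N + mrank M)%N ->
  (exists K, [/\ K \in F, #|K|.+2 = mrank M & (#|class_reps M K| < N.+2)%N]) ->
  let H := genm M a (Some (set0, N)) (mrank M).-2 in
  [/\ 0 < bform H a a, reverse_cauchy_schwarz H a
    & forall v, v != 0 -> bform H a v = 0 -> bform H v v < 0].
Proof.
move=> sM r2 a0 ai leN few H.
have r22 : (mrank M).-2.+2 = mrank M by case: (mrank M) r2 => [|[]].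
have Haa : 0 < bform H a a.
  by apply: bform_genm_gt0; rewrite ?indep0 // cards0 r22.
have rcs : reverse_cauchy_schwarz H a.
  apply: genm_rcs => //; rewrite /= r22; apply: leq_trans leN.
  by rewrite -[leqRHS]card_ord max_card.
split=> // v v0 av; rewrite lt_def (rcs_orth_le0 Haa rcs av) andbT.
apply: contra v0 => /eqP vv; apply/eqP.
apply: (genm_ker_trivial a0 ai sM r2 leN few).
exact: rcs_isotropic (genm_sym _ _ _ _) Haa rcs av (esym vv).
Qed.

Lemma hessian_basis_hyperplane (z : 'rV[R]_n) : simple_matroid M ->
  (2 <= mrank M)%N -> (forall i, 0 < z 0 i) ->
  let H := hessian_at (basis_poly M) z in
  [/\ H^T = H, 0 < bform H z z, reverse_cauchy_schwarz H z
    & forall v, v != 0 -> bform H z v = 0 -> bform H v v < 0].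
Proof.
move=> sM r2 z0 H.
have f0 : 0 < n`!%:R :> R by rewrite ltr0n fact_gt0.
have bE u w := bform_hessian_basis z u w r2.
have [||||] := @genm_hyperplane (pad z) n sM r2.
- by rewrite pad0.
- by move=> i; rewrite pad_lift.
- exact: leq_addr.
- have [||J /and3P[_]] := @exists_extends _ M set0 (mrank M).-2.
  + exact: indep0.
  + by rewrite cards0 add0n -subn2 leq_subr.
  rewrite setU0 => JF _ cJ; exists J; split => //.
    by rewrite cJ; case: (mrank M) r2 => [|[]].
  (* With [N = n] every contraction has few enough classes, as there are at most [n]; uniform
     matroids are covered too. *)
  apply: (@leq_ltn_trans n) => //; apply: leq_trans (card_class_reps_le _ _) _.
  by rewrite -[leqRHS]card_ord max_card.
rewrite bE pmulr_rgt0 // => Hzz rcs neg; split => //.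
- apply/matrixP => i j; rewrite mxE !hessian_at_basis_poly //.
  by congr (genv _ _ _ _); apply: dstepC.
- move=> v; have := rcs (pad v); rewrite !bE exprMn mulrACA -expr2.
  by rewrite ler_pM2l // exprn_gt0.
- move=> v v0 zv; have := neg (pad v); rewrite pad_eq0 !bE zv mulr0.
  by move=> /(_ v0 erefl); rewrite pmulr_rlt0.
Qed.

End Linking.

(** * Strict log-concavity *)

Section LogConcavePoly.
Variables (R : realType) (p : {poly R}).
Hypothesis p_gt0 : forall s, s \in `[0, 1] -> 0 < p.[s].
Hypothesis p_lc : forall s, s \in `[0, 1] -> p.[s] * p^`()^`().[s] < p^`().[s] ^+ 2.

Let lnp : R -> R := @ln R \o horner p.
Let dlnp (s : R) : R := p^`().[s] / p.[s].

Let is_derive_lnp (s : R) : s \in `[0, 1] -> is_derive s (1 : R) lnp (dlnp s).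
Proof.
move=> s01; rewrite /dlnp mulrC; apply: is_derive1_comp.
exact/is_derive1_ln/p_gt0.
Qed.

Let is_derive_dlnp (s : R) : s \in `[0, 1] -> is_derive s (1 : R) dlnp
  ((p.[s] * p^`()^`().[s] - p^`().[s] ^+ 2) / p.[s] ^+ 2).
Proof.
move=> s01; have pn0 : p.[s] != 0 by rewrite lt0r_neq0 ?p_gt0.
have dV := is_deriveV pn0 (is_derive_poly p s).
have := is_deriveM (is_derive_poly p^`() s) dV.
rewrite (_ : _ *: _ + _ *: _ =
  (p.[s] * p^`()^`().[s] - p^`().[s] ^+ 2) / p.[s] ^+ 2) //.
rewrite /GRing.scale /=; field; exact: pn0.
Qed.

Let sub01 (x y s : R) : 0 <= x -> y <= 1 -> s \in `]x, y[ -> s \in `[0, 1].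
Proof.
rewrite !in_itv /= => x0 y1 /andP[xs sy].
by rewrite (le_trans x0 (ltW xs)) (le_trans (ltW sy) y1).
Qed.

Let csub01 (x y s : R) : 0 <= x -> y <= 1 -> s \in `[x, y] -> s \in `[0, 1].
Proof.
rewrite !in_itv /= => x0 y1 /andP[xs sy].
by rewrite (le_trans x0 xs) (le_trans sy y1).
Qed.

Let mvt01 (f df : R -> R) (x y : R) : 0 <= x -> x < y -> y <= 1 ->
  (forall s : R, s \in `[0, 1] -> is_derive s (1 : R) f (df s)) ->
  exists2 c, c \in `]x, y[ & f y - f x = df c * (y - x).
Proof.
move=> x0 xy y1 fdf.
have fd s : s \in `]x, y[ -> is_derive s (1 : R) f (df s).
  by move=> sxy; apply: fdf; apply: sub01 sxy.
have fv : {in `[x, y], forall s, derivable f s 1}.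
  by move=> s sxy; apply: ex_derive; apply: fdf; apply: csub01 sxy.
exact: (MVT xy fd (derivable_within_continuous fv)).
Qed.

(** By [p_lc] the second derivative of [ln p] is negative. The mean value theorem on each side of
    [t], then for the derivative between the two points found, compares the slopes. *)
Lemma ln_poly_strictly_concave t : 0 < t < 1 ->
  (1 - t) * ln p.[0] + t * ln p.[1] < ln p.[t].
Proof.
move=> /andP[t0 t1].
have [c1] := mvt01 (lexx 0) t0 (ltW t1) is_derive_lnp.
rewrite in_itv /= => /andP[c10 c1t] e1.
have [c2] := mvt01 (ltW t0) t1 (lexx 1) is_derive_lnp.
rewrite in_itv /= => /andP[tc2 c21] e2.
have lt12 : c1 < c2 by apply: lt_trans tc2.
have [c c12 e] := mvt01 (ltW c10) lt12 (ltW c21) is_derive_dlnp.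
have c01 := sub01 (ltW c10) (ltW c21) c12.
have neg : dlnp c2 < dlnp c1.
  rewrite -subr_lt0 e pmulr_llt0 ?subr_gt0 // pmulr_llt0 ?subr_lt0 ?p_lc //.
  by rewrite invr_gt0 exprn_gt0 ?p_gt0.
rewrite /lnp /= in e1 e2.
rewrite subr0 in e1.
have : t * (1 - t) * dlnp c2 < t * (1 - t) * dlnp c1.
  by rewrite ltr_pM2l // mulr_gt0 // subr_gt0.
have : t * (ln p.[1] - ln p.[t]) = t * (dlnp c2 * (1 - t)) by rewrite e2.
have : (1 - t) * (ln p.[t] - ln p.[0]) = (1 - t) * (dlnp c1 * t) by rewrite e1.
lra.
Qed.

End LogConcavePoly.

(** * Log-concavity of the basis generating polynomial along lines *)

Section BasisLogConcave.
Variables (R : realType) (n : nat) (M : matroid n).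
Hypotheses (simpleM : simple_matroid M) (rank2 : (2 <= mrank M)%N).
Local Notation F := (indep_sets M).
Local Notation s0 := (Some (set0 : {set 'I_n}, 0%N)).

Let r22 : (mrank M).-2.+2 = mrank M.
Proof. by case: (mrank M) rank2 => [|[]]. Qed.

Lemma poly_at_basis_poly_gt0 (z : 'rV[R]_n) : (forall i, 0 < z 0 i) ->
  0 < poly_at (basis_poly M) z.
Proof.
move=> z0; rewrite poly_at_basis_poly.
have [||J eJ cJ] := @exists_extends _ M set0 (mrank M).
- exact: indep0.
- by rewrite cards0.
apply: genv_gt0 eJ _; rewrite ?pad0 ?cJ ?eqxx ?orbT // => i.
by rewrite pad_lift.
Qed.

Lemma hessian_basis_euler2 (z : 'rV[R]_n) :
  bform (hessian_at (basis_poly M) z) z z =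
  ((mrank M).-2.+2 * (mrank M).-2.+1)%:R * poly_at (basis_poly M) z.
Proof.
have f0 : n`!%:R != 0 :> R by rewrite pnatr_eq0 -lt0n fact_gt0.
apply: (mulfI f0); rewrite -bform_hessian_basis // bform_genm.
by rewrite genv_shift ?pad0 // poly_at_basis_poly r22; ring.
Qed.

Lemma hessian_basis_euler1 (z w : 'rV[R]_n) :
  bform (hessian_at (basis_poly M) z) z w =
  (mrank M).-2.+1%:R * \sum_j w 0 j *
    genv M (pad z) (dstep (lift ord0 j) s0) (mrank M).-2.+1.
Proof.
rewrite bformE exchange_big mulr_sumr; apply: eq_bigr => j _ /=.
rewrite mulrCA /genv gen_euler sum_pad mulr_sumr; apply: eq_bigr => i _.
by rewrite hessian_at_basis_poly // /genv; ring.
Qed.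

(** Evaluating [gen] at affine univariate polynomials restricts it to the line, and [gen_derivation]
    for [deriv] becomes the directional derivative along [w]. *)
Lemma basis_poly_line (x w : 'rV[R]_n) : exists p : {poly R}, forall s,
  [/\ p.[s] = poly_at (basis_poly M) (x + s *: w),
      p^`().[s] = \sum_j w 0 j *
        genv M (pad (x + s *: w)) (dstep (lift ord0 j) s0) (mrank M).-2.+1
    & p^`()^`().[s] = bform (hessian_at (basis_poly M) (x + s *: w)) w w].
Proof.
pose X k : {poly R} := (pad x 0 k)%:P + (pad w 0 k) *: 'X.
have DX k : (X k)^`() = (pad w 0 k)%:P.
  by rewrite /X derivD derivC derivZ derivX add0r -[RHS]mulr1 mul_polyC.
have D s d : (gen F X s d.+1)^`() = \sum_k (pad w 0 k)%:P * gen F X (dstep k s) d.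
  rewrite (@gen_derivation _ F _ (@deriv R) (@derivM R)).
  by apply: eq_bigr => k _; congr (_ * _); apply: DX.
have ev s d t : (gen F X s d).[t] = genv M (pad (x + t *: w)) s d.
  rewrite -[LHS]/(horner_eval t _) gen_rmorph; apply: eq_gen => k /=.
  rewrite /horner_eval /X !hornerE !mxE; case: unlift => [j|]; rewrite ?mxE.
    by rewrite mulrC.
  by rewrite mul0r addr0.
exists (gen F X s0 (mrank M).-2.+2) => s; split.
- by rewrite ev r22 poly_at_basis_poly.
- rewrite D horner_sum.
  under eq_bigr => k _ do rewrite hornerM hornerC ev.
  by rewrite sum_pad.
rewrite D (big_morph _ (@derivD R) (deriv0 R)) horner_sum bformE.
under eq_bigr => k _ do
  rewrite derivM derivC mul0r add0r hornerM hornerC D horner_sum.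
rewrite sum_pad exchange_big; apply: eq_bigr => j _.
transitivity (\sum_i pad w 0 i * (w 0 j * genv M (pad (x + s *: w))
    (dstep i (dstep (lift ord0 j) s0)) (mrank M).-2)).
  rewrite mulr_sumr; apply: eq_bigr => k _.
  by rewrite hornerM hornerC ev mulrCA.
rewrite sum_pad; apply: eq_bigr => i _.
by rewrite hessian_at_basis_poly //; ring.
Qed.

Lemma basis_poly_strictly_log_concave :
  strictly_log_concave_on (@positive_orthant R n) (poly_at (basis_poly M)).
Proof.
split=> [x x0|x y t x0 y0 xy /andP[t0 t1]]; first exact: poly_at_basis_poly_gt0.
pose w := y - x.
have w0 : w != 0 by rewrite subr_eq0 eq_sym; apply/eqP.
have [p pE] := basis_poly_line x w.
have z0 s : s \in `[0, 1] -> forall i, 0 < (x + s *: w) 0 i.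
  rewrite in_itv /= => /andP[s0' s1] i; rewrite !mxE.
  have := x0 i; have := y0 i; rewrite /=.
  have -> : x 0 i + s * (y 0 i - x 0 i) = (1 - s) * x 0 i + s * y 0 i by ring.
  move=> yi xi; have [s1'|s1'] := eqVneq s 1.
    by rewrite s1' subrr mul0r add0r mul1r.
  apply: ltr_pwDl; last by rewrite mulr_ge0 // ltW.
  by rewrite mulr_gt0 // subr_gt0 lt_neqAle s1'.
have pgt0 s : s \in `[0, 1] -> 0 < p.[s].
  by move=> s01; have [-> _ _] := pE s; apply/poly_at_basis_poly_gt0/z0.
have plc s : s \in `[0, 1] -> p.[s] * p^`()^`().[s] < p^`().[s] ^+ 2.
  move=> s01; have [ps p's p''s] := pE s.
  have [_ _ rcs neg] := hessian_basis_hyperplane simpleM rank2 (z0 s s01).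
  have := rcs w; have := neg w w0.
  rewrite hessian_basis_euler2 hessian_basis_euler1 -ps -p's -p''s.
  set d := (mrank M).-2; have := pgt0 s s01.
  move: p.[s] p^`().[s] p^`()^`().[s] => u u' u'' u0 neg' rc.
  (* If [u' = 0], then [w] is orthogonal to the base point and the form is negative at [w].
     Otherwise Euler's identities turn reverse Cauchy-Schwarz into r u u'' <= (r - 1) u'^2, which is
     strictly less than r u'^2. *)
  have [u'0|u'n0] := eqVneq u' 0.
    by rewrite u'0 expr0n pmulr_rlt0 // neg' // u'0 mulr0.
  have u'2 : 0 < u' ^+ 2 by rewrite lt_def sqrf_eq0 u'n0 sqr_ge0.
  move: rc; rewrite natrM -natr1; set e := d.+1%:R.
  have e0 : 0 < e by rewrite ltr0n.
  have -> : (e + 1) * e * u * u'' = e * ((e + 1) * (u * u'')) by ring.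
  have -> : (e * u') ^+ 2 = e * (e * u' ^+ 2) by ring.
  rewrite ler_pM2l // => rc.
  have : (e + 1) * (u * u'') < (e + 1) * u' ^+ 2.
    by apply: le_lt_trans rc _; rewrite ltr_pM2r // ltrDl.
  by rewrite ltr_pM2l // addr_gt0.
(* The line starts at [x], whose weight is [t], so the parameter is [1 - t]. *)
have := ln_poly_strictly_concave pgt0 plc (t := 1 - t).
have [-> _ _] := pE 0; have [-> _ _] := pE 1; have [-> _ _] := pE (1 - t).
rewrite scale0r addr0 scale1r /w subKr (addrC x (y - x)) subrK.
have -> : x + (1 - t) *: (y - x) = t *: x + (1 - t) *: y.
  by apply/rowP => i; rewrite !mxE; ring.
by apply; rewrite subr_gt0 t1 gtrBl.
Qed.

End BasisLogConcave.

(** * Signatures of both Hessians and strict log-concavity *)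

Theorem theorem1p1 (R : realType) (n : nat) (M : matroid n)
    (hsimple : simple_matroid M) (hrank : (2 <= mrank M)%N) :
  ((forall a : 'rV[R]_n, (forall i, 0 < a ord0 i) ->
      lorentzian_signature (hessian_at (basis_poly M) a)) /\
   strictly_log_concave_on (@positive_orthant R n) (poly_at (basis_poly M))) /\
  (~ uniform_matroid M ->
   forall a : 'rV[R]_(n.+1),
     0 <= a ord0 ord0 -> (forall i : 'I_n, 0 < a ord0 (lift ord0 i)) ->
     lorentzian_signature (hessian_at (reduced_indep_poly M) a)).
Proof.
split; [split=> [a a0|]|move=> nonunif a a0 ai].
- have [Hs Haa _ neg] := hessian_basis_hyperplane hsimple hrank a0.
  exact: lorentzian_signature_of_hyperplane Hs Haa neg.
- exact: basis_poly_strictly_log_concave.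
rewrite hessian_at_reduced_indep_poly //.
have [|Haa _ neg] := genm_hyperplane hsimple hrank a0 ai _
  (exists_few_classes hrank nonunif).
  by rewrite subnK // mrank_le.
exact: lorentzian_signature_of_hyperplane (genm_sym _ _ _ _) Haa neg.
Qed.
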